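(* There exists a continuum $Y$ which is an almost Slovak space, is not a Slovak space, and is such that every minimal continuous map $G:Y\to Y$ is a homeomorphism (i.e. $Y$ admits no minimal noninvertible map).
   Context: A continuous map $T:X\to X$ on a compact metric space $X$ is minimal if for every $x\in X$ the forward orbit $\{T^n(x):n\in\mathbb{N}\}$ is dense in $X$. A continuum is a compact connected nondegenerate metric space. $H(X)$ denotes the group of all homeomorphisms of $X$. A nondegenerate compact metric space $X$ is a Slovak space if $H(X)=\{T^n:n\in\mathbb{Z}\}$ for some minimal homeomorphism $T$. A compact metric space $X$ is an almost Slovak space if $H(X)=H_+(X)\cup H_-(X)$ with $H_+(X)\cap H_-(X)=\{\mathrm{id}_X\}$, where $H_+(X)$ is a cyclic group generated by a minimal homeomorphism, and $g^2\in H_+(X)$ for every $g\in H_-(X)$. *)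

(* Defs.v *)
From Stdlib Require Import Reals ZArith List.
Open Scope R_scope.

Record MetricSpace : Type := {
  carrier :> Type;
  dist : carrier -> carrier -> R;
  dist_nonneg : forall x y, 0 <= dist x y;
  dist_eq0 : forall x y, dist x y = 0 <-> x = y;
  dist_sym : forall x y, dist x y = dist y x;
  dist_tri : forall x y z, dist x z <= dist x y + dist y z
}.
Arguments dist {m} _ _.

Section Topology.
Variable X : MetricSpace.

Definition is_open (U : X -> Prop) : Prop :=
  forall x, U x -> exists eps, 0 < eps /\ forall y, dist x y < eps -> U y.

Definition compact : Prop :=
  forall (I : Type) (U : I -> X -> Prop),
    (forall i, is_open (U i)) ->
    (forall x, exists i, U i x) ->
    exists l : list I, forall x, exists i, In i l /\ U i x.

Definition connected : Prop :=
  forall U V : X -> Prop, is_open U -> is_open V ->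
    (forall x, U x \/ V x) -> (forall x, ~ (U x /\ V x)) ->
    (forall x, U x) \/ (forall x, V x).

Definition nondegenerate : Prop := exists x y : X, x <> y.

Definition continuum : Prop := compact /\ connected /\ nondegenerate.

Definition continuous (f : X -> X) : Prop :=
  forall x eps, 0 < eps -> exists delta, 0 < delta /\
    forall y, dist x y < delta -> dist (f x) (f y) < eps.

Definition dense (A : X -> Prop) : Prop :=
  forall y eps, 0 < eps -> exists a, A a /\ dist a y < eps.

Fixpoint iter (n : nat) (f : X -> X) (x : X) : X :=
  match n with O => x | S m => f (iter m f x) end.

Definition minimal (T : X -> X) : Prop :=
  continuous T /\ forall x, dense (fun y => exists n : nat, y = iter n T x).

Definition homeo (f : X -> X) : Prop :=
  continuous f /\ exists g : X -> X, continuous g /\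
    (forall x, g (f x) = x) /\ (forall x, f (g x) = x).

Definition zpow (T Tinv : X -> X) (n : Z) : X -> X :=
  match n with
  | Z0 => fun x => x
  | Zpos p => iter (Pos.to_nat p) T
  | Zneg p => iter (Pos.to_nat p) Tinv
  end.

Definition is_inverse (T Tinv : X -> X) : Prop :=
  (forall x, Tinv (T x) = x) /\ (forall x, T (Tinv x) = x).

Definition slovak : Prop :=
  nondegenerate /\
  exists T Tinv : X -> X, homeo T /\ is_inverse T Tinv /\ minimal T /\
    forall h : X -> X, homeo h <-> exists n : Z, h = zpow T Tinv n.

Definition almost_slovak : Prop :=
  exists (T Tinv : X -> X) (Hm : (X -> X) -> Prop),
    homeo T /\ is_inverse T Tinv /\ minimal T /\
    let Hp := fun h : X -> X => exists n : Z, h = zpow T Tinv n in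
    (forall h, homeo h <-> (Hp h \/ Hm h)) /\
    (forall h, (Hp h /\ Hm h) <-> h = (fun x => x)) /\
    (forall g, Hm g -> Hp (fun x => g (g x))).

End Topology.

(* Main.v *)
From Stdlib Require Import Reals ZArith List Lra Lia.
From Stdlib Require Import Classical ClassicalEpsilon FunctionalExtensionality ProofIrrelevance.
From Coquelicot Require Import Complex.
Require Import Defs.
Open Scope R_scope.

(** Let [X] be the dyadic solenoid, with its flow [flow] whose time-one map is minimal, and let
    [iota] be the orbit of the neutral element.  Blow up every point [iota n], [n] an integer, to a
    circle: [Y] is the set of pairs [(x, v)], [v] a [Z]-indexed family of unit complex numbers, with
    [v n = exp (i / rho (x - iota n))] whenever [x <> iota n], where [rho] is the distance to the
    neutral element.  Both [T (x, v) = (x + iota 1, v shifted)] and the reflection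
    [R (x, v) = (- x, v reversed)] act on [Y].

    A path in [Y] over the orbit [iota] cannot leave the circle over [iota n], nor cross it, because
    of the oscillation.  Hence a continuous surjection [G] of [Y] maps each cell (the part over
    [iota [n, n + 1]]) into a cell, say the [m n]-th one, with [|m (n + 1) - m n| <= 1].  If [G]
    moves all far enough cells by the same [k], then [G = T^k], since the circles over [iota n]
    shrink and are dense.  If [G] is a homeomorphism, [m] is injective, so [m n = k + n] or [k - n],
    and [G] is [T^k] or [T^k R].  If [G] is minimal, it has no invariant cell or pair of cells, so
    [m n - n] has constant sign; when positive it is nonincreasing, hence eventually constant, and
    again [G = T^k].  The group of homeomorphisms is therefore infinite dihedral. *)

(** The leaf of [iota] is singled out by its paths: they are trapped in single cells, whereas every
    other leaf is one continuous dense path of [Y]. So a surjection sends no point off this leaf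
    into it, for then a dense leaf, and with it all of [Y], would go into one closed cell. Since the
    point over [iota 0] has a preimage, some cell goes into a cell. The obstacle is the passage to
    the neighbouring cells: no path joins a circle to its two spirals, so it has to be excluded that
    [G] keeps a circle over the leaf and throws a spiral onto another leaf. The circles carry
    weights tending to [0], which is why [G] is determined by its action on far cells; [rho] is
    invariant under inversion, which lets [R] act. A minimal map being a power of [T], the group it
    generates never contains [R], so [Y] is not a Slovak space. *)

Definition cont_at {M N : MetricSpace} (f : M -> N) (x : M) : Prop :=
  forall eps, 0 < eps -> exists delta, 0 < delta /\
    forall y, dist x y < delta -> dist (f x) (f y) < eps.

(** On a single space this is convertible with [continuous], so hypotheses and goals of the theorem
    are used at this type directly. *)
Definition mcont (M N : MetricSpace) (f : M -> N) : Prop := forall x, cont_at f x.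

Lemma dist_refl (M : MetricSpace) (x : M) : dist x x = 0.
Proof. now apply dist_eq0. Qed.

Lemma cont_at_comp (M N P : MetricSpace) (f : M -> N) (g : N -> P) x :
  cont_at f x -> cont_at g (f x) -> cont_at (fun y => g (f y)) x.
Proof.
  intros Hf Hg eps He. destruct (Hg eps He) as [d [Hd H]].
  destruct (Hf d Hd) as [d' [Hd' H']]. exists d'. split; auto.
Qed.

Lemma mcont_comp (M N P : MetricSpace) (f : M -> N) (g : N -> P) :
  mcont M N f -> mcont N P g -> mcont M P (fun y => g (f y)).
Proof. intros Hf Hg x. apply (cont_at_comp _ _ _ f g); auto. Qed.

Lemma cont_at_ext_near (M N : MetricSpace) (f g : M -> N) x r :
  0 < r -> (forall y, dist x y < r -> f y = g y) -> cont_at g x -> cont_at f x.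
Proof.
  intros Hr E H eps He. destruct (H eps He) as [d [Hd H']].
  exists (Rmin r d). split; [now apply Rmin_pos|].
  intros y Hy. rewrite (E x), (E y).
  - apply H'. eapply Rlt_le_trans; [exact Hy|apply Rmin_r].
  - eapply Rlt_le_trans; [exact Hy|apply Rmin_l].
  - now rewrite dist_refl.
Qed.

Lemma archi_small (eps : R) : 0 < eps -> exists N, forall n, (N <= n)%nat -> / INR (S n) < eps.
Proof.
  intros He. destruct (archimed_cor1 eps He) as [N [H1 H2]]. exists N. intros n Hn.
  eapply Rle_lt_trans; [|exact H1]. apply Rinv_le_contravar.
  - now apply lt_0_INR.
  - apply le_INR. lia.
Qed.

Lemma inv_INR_pos n : 0 < / INR (S n).
Proof. apply Rinv_0_lt_compat, lt_0_INR. lia. Qed.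

(** * Compactness of metric spaces *)

(** Without a cluster point every point has a ball that [u] leaves for good; finitely many such
    balls cover the space, and a late [u N] lies in none of them. *)
Lemma compact_cluster (M : MetricSpace) (HM : compact M) (u : nat -> M) :
  exists y, forall eps, 0 < eps -> forall N, exists n, (N <= n)%nat /\ dist (u n) y < eps.
Proof.
  apply NNPP. intros Hno.
  assert (Hy : forall y, exists p : R * nat, 0 < fst p /\
            forall n, (snd p <= n)%nat -> ~ dist (u n) y < fst p).
  { intros y. apply NNPP. intros H. apply Hno. exists y. intros eps He N.
    apply NNPP. intros H'. apply H. exists (eps, N). split; [exact He|].
    intros n Hn Hd. apply H'. exists n. auto. }
  set (p := fun y => proj1_sig (constructive_indefinite_description _ (Hy y))).
  assert (Hp : forall y, 0 < fst (p y) /\ forall n, (snd (p y) <= n)%nat -> ~ dist (u n) y < fst (p y)).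
  { intros y. unfold p. now destruct (constructive_indefinite_description _ (Hy y)). }
  destruct (HM M (fun c y => dist y c < fst (p c))) as [l Hl].
  - intros c x Hx. exists (fst (p c) - dist x c). split; [lra|].
    intros y Hxy. pose proof (dist_tri _ y x c). rewrite (dist_sym _ y x) in H. lra.
  - intros x. exists x. rewrite dist_refl. apply Hp.
  - assert (Hb : exists N, forall c, In c l -> (snd (p c) <= N)%nat).
    { clear Hl. induction l as [|c l [N IH]].
      - exists 0%nat. intros c [].
      - exists (Nat.max N (snd (p c))). intros c' [->|H]; [lia|]. specialize (IH _ H). lia. }
    destruct Hb as [N HN]. destruct (Hl (u N)) as [c [Hc Hd]].
    exact (proj2 (Hp c) N (HN c Hc) Hd).
Qed.

Definition complete (M : MetricSpace) : Prop :=
  forall u : nat -> M,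
    (forall eps, 0 < eps -> exists N, forall p q, (N <= p)%nat -> (N <= q)%nat -> dist (u p) (u q) < eps) ->
    exists x, forall eps, 0 < eps -> exists N, forall n, (N <= n)%nat -> dist (u n) x < eps.

Definition totally_bounded (M : MetricSpace) : Prop :=
  forall eps, 0 < eps -> exists l : list (M -> Prop),
    (forall x, exists P, In P l /\ P x) /\
    (forall P x y, In P l -> P x -> P y -> dist x y < eps).

(** Subdivision: a set not covered by finitely many [U i] contains another such set of arbitrarily
    small diameter. Points of a nested sequence of these converge, and one [U i] around the limit
    swallows a late set. *)
Lemma complete_tb_compact (M : MetricSpace) :
  complete M -> totally_bounded M -> compact M.
Proof.
  intros HC HT I U HU Hcov. apply NNPP. intros Hno.
  set (bad := fun A : M -> Prop => ~ exists l : list I, forall x, A x -> exists i, In i l /\ U i x).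
  assert (Hstep : forall A eps, bad A -> 0 < eps ->
            exists B, bad B /\ (forall x, B x -> A x) /\
                      (forall x y, B x -> B y -> dist x y < eps)).
  { intros A eps HA He. destruct (HT eps He) as [l [Hl1 Hl2]].
    apply NNPP. intros H. apply HA.
    assert (Hfin : forall l', (forall P, In P l' -> In P l) ->
              exists li : list I, forall x, A x -> (exists P, In P l' /\ P x) ->
                 exists i, In i li /\ U i x).
    { induction l' as [|P l' IH]; intros Hsub.
      - exists nil. intros x _ [P [[] _]].
      - destruct IH as [li Hli]; [intros; apply Hsub; now right|].
        assert (HP : exists lj : list I, forall x, A x /\ P x -> exists i, In i lj /\ U i x).
        { apply NNPP. intros HB. apply H. exists (fun x => A x /\ P x).
          split; [exact HB|]. split; [tauto|].
          intros x y [_ Hx] [_ Hy]. apply (Hl2 P); auto. apply Hsub. now left. }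
        destruct HP as [lj Hlj]. exists (li ++ lj). intros x HAx [Q [[<-|HQ] HQx]].
        + destruct (Hlj x) as [i [Hi Hi']]; [tauto|]. exists i. split; [|auto].
          apply in_or_app. auto.
        + destruct (Hli x HAx) as [i [Hi Hi']]; [now exists Q|]. exists i. split; [|auto].
          apply in_or_app. auto. }
    destruct (Hfin l) as [li Hli]; [auto|]. exists li. intros x Hx. apply Hli; auto. }
  assert (Hall : bad (fun _ => True)).
  { intros [l Hl]. apply Hno. exists l. intros x. now apply Hl. }
  set (St := {A : M -> Prop | bad A}).
  assert (Hnext : forall (n : nat) (A : St), exists B : St,
            (forall x, proj1_sig B x -> proj1_sig A x) /\
            (forall x y, proj1_sig B x -> proj1_sig B y -> dist x y < / INR (S n))).
  { intros n [A HA]. destruct (Hstep A (/ INR (S n)) HA (inv_INR_pos n)) as [B [HB HB']].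
    now exists (exist _ B HB). }
  set (next := fun n A => proj1_sig (constructive_indefinite_description _ (Hnext n A))).
  set (seq := fix seq n : St := match n with O => exist _ _ Hall | S k => next k (seq k) end).
  assert (Hseq : forall n,
            (forall x, proj1_sig (seq (S n)) x -> proj1_sig (seq n) x) /\
            (forall x y, proj1_sig (seq (S n)) x -> proj1_sig (seq (S n)) y -> dist x y < / INR (S n))).
  { intros n. change (seq (S n)) with (next n (seq n)). unfold next.
    destruct (constructive_indefinite_description _ (Hnext n (seq n))) as [B HB]. exact HB. }
  assert (Hmono : forall n k x, proj1_sig (seq (n + k)%nat) x -> proj1_sig (seq n) x).
  { intros n k; induction k as [|k IH]; intros x Hx.
    - now rewrite Nat.add_0_r in Hx.
    - rewrite Nat.add_succ_r in Hx. apply IH. now apply Hseq. }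
  assert (Hne : forall n, exists x, proj1_sig (seq n) x).
  { intros n. apply NNPP. intros H. apply (proj2_sig (seq n)). exists nil. intros x Hx.
    exfalso. apply H. now exists x. }
  set (u := fun n => proj1_sig (constructive_indefinite_description _ (Hne (S n)))).
  assert (Hu : forall n, proj1_sig (seq (S n)) (u n)).
  { intros n. unfold u. now destruct (constructive_indefinite_description _ (Hne (S n))). }
  assert (Hu' : forall n p, (n <= p)%nat -> proj1_sig (seq (S n)) (u p)).
  { intros n p Hp. apply (Hmono (S n) (p - n)%nat).
    replace (S n + (p - n))%nat with (S p) by lia. apply Hu. }
  destruct (HC u) as [x Hx].
  { intros eps He. destruct (archi_small eps He) as [N HN]. exists N. intros p q Hp Hq.
    eapply Rlt_trans; [apply (proj2 (Hseq N)); now apply Hu'|]. now apply HN. }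
  destruct (Hcov x) as [i Hi]. destruct (HU i x Hi) as [eps [He Heps]].
  destruct (Hx (eps / 2)) as [N1 HN1]; [lra|].
  destruct (archi_small (eps / 2)) as [N2 HN2]; [lra|].
  set (N := Nat.max N1 N2).
  apply (proj2_sig (seq (S N))). exists (i :: nil). intros y Hy. exists i. split; [now left|].
  apply Heps.
  assert (H1 : dist (u N) x < eps / 2) by (apply HN1; lia).
  assert (H2 : dist (u N) y < / INR (S N)) by (apply (proj2 (Hseq N)); auto).
  assert (H3 : / INR (S N) < eps / 2) by (apply HN2; lia).
  pose proof (dist_tri _ x (u N) y). rewrite (dist_sym _ x (u N)) in H. lra.
Qed.

(** * The real line and the complex plane as metric spaces *)

Definition R_metric : MetricSpace.
Proof.
  refine (Build_MetricSpace R (fun x y => Rabs (x - y)) _ _ _ _).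
  - intros. apply Rabs_pos.
  - intros x y. split; intros H.
    + apply Rminus_diag_uniq. apply NNPP. intros H'. now apply (Rabs_no_R0 _ H').
    + subst. rewrite Rminus_diag. apply Rabs_R0.
  - intros. apply Rabs_minus_sym.
  - intros x y z. replace (x - z) with ((x - y) + (y - z)) by ring. apply Rabs_triang.
Defined.

Definition C_metric : MetricSpace.
Proof.
  refine (Build_MetricSpace C (fun x y => Cmod (x - y)) _ _ _ _).
  - intros. apply Cmod_ge_0.
  - intros x y. split; intros H.
    + apply Cmod_eq_0 in H. replace x with (x - y + y)%C by ring. rewrite H. ring.
    + subst. replace (y - y)%C with (RtoC 0) by ring. apply Cmod_0.
  - intros x y. replace (x - y)%C with (- (y - x))%C by ring. apply Cmod_opp.
  - intros x y z. replace (x - z)%C with ((x - y) + (y - z))%C by ring. apply Cmod_triangle.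
Defined.

Lemma mcont_continuity (f : R -> R) : mcont R_metric R_metric f <-> continuity f.
Proof.
  split.
  - intros H x eps He. destruct (H x eps He) as [d [Hd H']]. exists d. split; [exact Hd|].
    intros y [_ Hy]. simpl in *. unfold R_dist, Rdist in *. rewrite Rabs_minus_sym. apply H'.
    now rewrite Rabs_minus_sym.
  - intros H x eps He. destruct (H x eps He) as [d [Hd H']]. exists d. split; [exact Hd|].
    intros y Hy. simpl in *. unfold R_dist, Rdist in *.
    destruct (Req_dec x y) as [->|Hne].
    + rewrite Rminus_diag, Rabs_R0. exact He.
    + rewrite Rabs_minus_sym. apply H'. split; [split; [exact I|exact Hne]|].
      now rewrite Rabs_minus_sym.
Qed.

Lemma IVT_value (f : R -> R) a b c : mcont R_metric R_metric f -> a <= b ->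
  (f a <= c <= f b \/ f b <= c <= f a) -> exists z, a <= z <= b /\ f z = c.
Proof.
  intros Hf Hab H. apply mcont_continuity in Hf.
  assert (Hg : forall g, continuity g -> g a <= 0 <= g b -> exists z, a <= z <= b /\ g z = 0).
  { intros g Cg Hg. destruct (IVT_cor g a b Cg Hab) as [z Hz]; [nra|]. now exists z. }
  destruct H as [H|H].
  - destruct (Hg (fun x => f x - c)) as [z [Hz Ez]].
    + apply (continuity_minus f (fun _ => c)); [exact Hf|]. apply continuity_const. now intros x y.
    + lra.
    + exists z. split; [exact Hz|lra].
  - destruct (Hg (fun x => c - f x)) as [z [Hz Ez]].
    + apply (continuity_minus (fun _ => c) f); [|exact Hf]. apply continuity_const. now intros x y.
    + lra.
    + exists z. split; [exact Hz|lra].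
Qed.

(** The supremum of the zeros. It serves as the last moment at which a path visits a circle. *)
Lemma last_zero (f : R -> R) a b : mcont R_metric R_metric f -> a < b -> f a = 0 -> f b <> 0 ->
  exists c, a <= c < b /\ f c = 0 /\ forall x, c < x <= b -> f x <> 0.
Proof.
  intros Hf Hab Ha Hb.
  destruct (completeness (fun x => a <= x <= b /\ f x = 0)) as [c [Hc1 Hc2]].
  - exists b. intros x [Hx _]. lra.
  - exists a. split; [lra|exact Ha].
  - assert (Hac : a <= c) by (apply Hc1; split; [lra|exact Ha]).
    assert (Hcb : c <= b) by (apply Hc2; intros x [Hx _]; lra).
    assert (Hfc : f c = 0).
    { apply NNPP. intros Hne.
      assert (Hpos : 0 < Rabs (f c)) by now apply Rabs_pos_lt.
      destruct (Hf c _ Hpos) as [d [Hd H]].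
      assert (Hub : is_upper_bound (fun x => a <= x <= b /\ f x = 0) (c - d)).
      { intros x [Hx Ex]. apply Rnot_lt_le. intros Hlt.
        assert (x <= c) by (apply Hc1; tauto).
        assert (Hdist : @dist R_metric c x < d) by (simpl; rewrite Rabs_pos_eq; lra).
        specialize (H x Hdist). simpl in H. rewrite Ex, Rminus_0_r in H. lra. }
      specialize (Hc2 _ Hub). lra. }
    exists c. split; [split; [exact Hac|]|split; [exact Hfc|]].
    + destruct (Rle_lt_or_eq_dec _ _ Hcb) as [H|H]; [exact H|]. subst c. contradiction.
    + intros x Hx Ex. assert (x <= c) by (apply Hc1; split; [lra|exact Ex]). lra.
Qed.

(** * Weighted sup metrics *)

(** [wt_fin] makes the sup metric below induce the product topology: up to [eps] only finitely many
    coordinates count. *)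
Record weight (I : Type) : Type := {
  wt :> I -> R;
  wt_pos : forall i, 0 < wt i;
  wt_le1 : forall i, wt i <= 1;
  wt_fin : forall eps, 0 < eps -> exists l : list I, forall i, In i l \/ wt i < eps
}.
Arguments wt {I} _ _.
Arguments wt_pos {I} _ _.
Arguments wt_le1 {I} _ _.
Arguments wt_fin {I} _ _ _.

Definition wterm {I} (w : weight I) (f g : I -> C) (i : I) : R :=
  wt w i * Rmin 1 (Cmod (f i - g i)).

(** The value [0] is adjoined so that the set is inhabited and the distance nonnegative even without
    indices; the truncation at [1] in [wterm] bounds the terms by the weights. *)
Definition wdist {I} (w : weight I) (f g : I -> C) : R :=
  epsilon (inhabits 0) (is_lub (fun r => r = 0 \/ exists i, r = wterm w f g i)).

Lemma Rmin1_bounds x : 0 <= x -> 0 <= Rmin 1 x <= 1.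
Proof. intros H. unfold Rmin. destruct (Rle_dec 1 x); lra. Qed.

Lemma wterm_bounds {I} (w : weight I) f g i : 0 <= wterm w f g i <= wt w i.
Proof.
  unfold wterm. pose proof (wt_pos w i). pose proof (Rmin1_bounds _ (Cmod_ge_0 (f i - g i))). nra.
Qed.

Lemma wdist_lub {I} (w : weight I) f g :
  is_lub (fun r => r = 0 \/ exists i, r = wterm w f g i) (wdist w f g).
Proof.
  unfold wdist. apply epsilon_spec.
  destruct (completeness (fun r => r = 0 \/ exists i, r = wterm w f g i)) as [m Hm].
  - exists 1. intros r [->|[i ->]]; [lra|].
    pose proof (wterm_bounds w f g i). pose proof (wt_le1 w i). lra.
  - exists 0. now left.
  - now exists m.
Qed.

Lemma wdist_ge0 {I} (w : weight I) f g : 0 <= wdist w f g.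
Proof. apply (proj1 (wdist_lub w f g)). now left. Qed.

Lemma wdist_term {I} (w : weight I) f g i : wterm w f g i <= wdist w f g.
Proof. apply (proj1 (wdist_lub w f g)). right. now exists i. Qed.

Lemma wdist_le {I} (w : weight I) f g r :
  0 <= r -> (forall i, wterm w f g i <= r) -> wdist w f g <= r.
Proof.
  intros Hr H. apply (proj2 (wdist_lub w f g)). intros x [->|[i ->]]; auto.
Qed.

Lemma wterm_ext {I} (w : weight I) f g f' g' i :
  Cmod (f i - g i) = Cmod (f' i - g' i) -> wterm w f g i = wterm w f' g' i.
Proof. unfold wterm. now intros ->. Qed.

Lemma wdist_ext {I} (w : weight I) f g f' g' :
  (forall i, Cmod (f i - g i) = Cmod (f' i - g' i)) -> wdist w f g = wdist w f' g'.
Proof.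
  intros H. apply Rle_antisym; apply wdist_le; try apply wdist_ge0; intros i.
  - rewrite (wterm_ext w f g f' g'); auto. apply wdist_term.
  - rewrite <- (wterm_ext w f g f' g'); auto. apply wdist_term.
Qed.

Lemma Cmod_minus_sym (a b : C) : Cmod (a - b) = Cmod (b - a).
Proof. replace (a - b)%C with (- (b - a))%C by ring. apply Cmod_opp. Qed.

Lemma Cmod_minus_eq0 (a b : C) : Cmod (a - b) = 0 -> a = b.
Proof.
  intros H. apply Cmod_eq_0 in H. replace a with (a - b + b)%C by ring. rewrite H. ring.
Qed.

Lemma wdist_sym {I} (w : weight I) f g : wdist w f g = wdist w g f.
Proof. apply wdist_ext. intros. apply Cmod_minus_sym. Qed.

Lemma wdist_tri {I} (w : weight I) f g h : wdist w f h <= wdist w f g + wdist w g h.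
Proof.
  apply wdist_le.
  - pose proof (wdist_ge0 w f g). pose proof (wdist_ge0 w g h). lra.
  - intros i. apply Rle_trans with (wterm w f g i + wterm w g h i).
    + unfold wterm. rewrite <- Rmult_plus_distr_l. apply Rmult_le_compat_l.
      * left. apply wt_pos.
      * assert (H : Cmod (f i - h i) <= Cmod (f i - g i) + Cmod (g i - h i)).
        { replace (f i - h i)%C with ((f i - g i) + (g i - h i))%C by ring. apply Cmod_triangle. }
        pose proof (Cmod_ge_0 (f i - g i)). pose proof (Cmod_ge_0 (g i - h i)).
        unfold Rmin. repeat destruct Rle_dec; lra.
    + apply Rplus_le_compat; apply wdist_term.
Qed.

Lemma wdist_coord {I} (w : weight I) i eps : 0 < eps ->
  exists delta, 0 < delta /\ forall f g, wdist w f g < delta -> Cmod (f i - g i) < eps.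
Proof.
  intros He. exists (wt w i * Rmin 1 eps). pose proof (wt_pos w i) as Hw.
  assert (0 < Rmin 1 eps) by (apply Rmin_pos; lra).
  split; [now apply Rmult_lt_0_compat|].
  intros f g H1. pose proof (wdist_term w f g i) as H2. unfold wterm in H2.
  assert (H3 : Rmin 1 (Cmod (f i - g i)) < Rmin 1 eps) by nra.
  revert H3. unfold Rmin. repeat destruct Rle_dec; lra.
Qed.

(** The converse of [wdist_coord]: coordinatewise closeness is enough, since coordinates outside [l]
    contribute less than [eps / 2] by their weight alone. *)
Lemma wdist_small {I} (w : weight I) eps : 0 < eps ->
  exists (l : list I) delta, 0 < delta /\
    forall f g, (forall i, In i l -> Cmod (f i - g i) < delta) -> wdist w f g < eps.
Proof.
  intros He. destruct (wt_fin w (eps / 2)) as [l Hl]; [lra|].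
  exists l, (eps / 2). split; [lra|]. intros f g H.
  apply Rle_lt_trans with (eps / 2); [|lra]. apply wdist_le; [lra|].
  intros i. destruct (Hl i) as [Hi|Hi].
  - specialize (H i Hi). unfold wterm. pose proof (wt_pos w i). pose proof (wt_le1 w i).
    pose proof (Rmin_r 1 (Cmod (f i - g i))).
    pose proof (Rmin1_bounds _ (Cmod_ge_0 (f i - g i))). nra.
  - pose proof (wterm_bounds w f g i). lra.
Qed.

Lemma wdist_refl {I} (w : weight I) f : wdist w f f = 0.
Proof.
  apply Rle_antisym; [|apply wdist_ge0]. apply wdist_le; [lra|]. intros i. unfold wterm.
  replace (f i - f i)%C with (RtoC 0) by ring. rewrite Cmod_0, Rmin_right; lra.
Qed.

Lemma wdist_eq0 {I} (w : weight I) f g : wdist w f g = 0 -> f = g.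
Proof.
  intros H. apply functional_extensionality. intros i. apply Cmod_minus_eq0.
  apply Rle_antisym; [|apply Cmod_ge_0]. apply le_epsilon. intros eps He.
  destruct (wdist_coord w i eps He) as [d [Hd H']]. rewrite Rplus_0_l. left. apply H'. lra.
Qed.

Definition fun_metric {I} (w : weight I) (P : (I -> C) -> Prop) : MetricSpace.
Proof.
  refine (Build_MetricSpace {f : I -> C | P f}
            (fun f g => wdist w (proj1_sig f) (proj1_sig g)) _ _ _ _).
  - intros. apply wdist_ge0.
  - intros [f Hf] [g Hg]. simpl. split.
    + intros H. apply wdist_eq0 in H. subst g. f_equal. apply proof_irrelevance.
    + intros H. injection H as ->. apply wdist_refl.
  - intros. apply wdist_sym.
  - intros. apply wdist_tri.
Defined.

Lemma cont_at_into_fun {I} (w : weight I) (P : (I -> C) -> Prop) (M : MetricSpace)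
    (f : M -> fun_metric w P) x :
  (forall i, @cont_at M C_metric (fun y => proj1_sig (f y) i) x) -> cont_at f x.
Proof.
  intros H eps He. destruct (wdist_small w eps He) as [l [d [Hd Hs]]].
  assert (Hl : exists r, 0 < r /\ forall y, dist x y < r ->
             forall i, In i l -> Cmod (proj1_sig (f x) i - proj1_sig (f y) i) < d).
  { clear Hs. induction l as [|i l [r [Hr IH]]].
    - exists 1. split; [lra|]. intros y _ i [].
    - destruct (H i d Hd) as [r' [Hr' H']]. exists (Rmin r r'). split; [now apply Rmin_pos|].
      intros y Hy j [<-|Hj].
      + apply (H' y). eapply Rlt_le_trans; [exact Hy|apply Rmin_r].
      + apply IH; [|exact Hj]. eapply Rlt_le_trans; [exact Hy|apply Rmin_l]. }
  destruct Hl as [r [Hr H']]. exists r. split; [exact Hr|]. intros y Hy. apply Hs. now apply H'.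
Qed.

Lemma cont_at_coord {I} (w : weight I) (P : (I -> C) -> Prop) i (x : fun_metric w P) :
  @cont_at (fun_metric w P) C_metric (fun y => proj1_sig y i) x.
Proof.
  intros eps He. destruct (wdist_coord w i eps He) as [d [Hd H]]. exists d. split; [exact Hd|].
  intros y Hy. now apply H.
Qed.

(** * Compactness of closed sets of bounded families *)

Lemma Cmod_le_re_im (z : C) : Cmod z <= Rabs (fst z) + Rabs (snd z).
Proof.
  unfold Cmod. apply Rsqr_incr_0_var.
  - rewrite Rsqr_sqrt by nra. unfold Rsqr.
    pose proof (Rabs_pos (fst z)). pose proof (Rabs_pos (snd z)).
    pose proof (pow2_abs (fst z)). pose proof (pow2_abs (snd z)). nra.
  - pose proof (Rabs_pos (fst z)). pose proof (Rabs_pos (snd z)). lra.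
Qed.

Lemma re_le_Cmod (z : C) : Rabs (fst z) <= Cmod z.
Proof. eapply Rle_trans; [apply Rmax_l|apply Rmax_Cmod]. Qed.

Lemma im_le_Cmod (z : C) : Rabs (snd z) <= Cmod z.
Proof. eapply Rle_trans; [apply Rmax_r|apply Rmax_Cmod]. Qed.

Lemma C_complete (u : nat -> C) :
  (forall eps, 0 < eps -> exists N, forall p q, (N <= p)%nat -> (N <= q)%nat -> Cmod (u p - u q) < eps) ->
  exists z, forall eps, 0 < eps -> exists N, forall n, (N <= n)%nat -> Cmod (u n - z) < eps.
Proof.
  intros H.
  assert (H1 : Cauchy_crit (fun n => fst (u n))).
  { intros eps He. destruct (H eps He) as [N HN]. exists N. intros p q Hp Hq.
    eapply Rle_lt_trans; [|exact (HN p q Hp Hq)]. apply (re_le_Cmod (u p - u q)). }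
  assert (H2 : Cauchy_crit (fun n => snd (u n))).
  { intros eps He. destruct (H eps He) as [N HN]. exists N. intros p q Hp Hq.
    eapply Rle_lt_trans; [|exact (HN p q Hp Hq)]. apply (im_le_Cmod (u p - u q)). }
  destruct (R_complete _ H1) as [a Ha]. destruct (R_complete _ H2) as [b Hb].
  exists (a, b). intros eps He.
  destruct (Ha (eps / 2)) as [N1 HN1]; [lra|]. destruct (Hb (eps / 2)) as [N2 HN2]; [lra|].
  exists (Nat.max N1 N2). intros n Hn.
  assert (A : Rdist (fst (u n)) a < eps / 2) by (apply HN1; lia).
  assert (B : Rdist (snd (u n)) b < eps / 2) by (apply HN2; lia).
  eapply Rle_lt_trans; [apply Cmod_le_re_im|].
  change (Rabs (fst (u n) - a) + Rabs (snd (u n) - b) < eps). unfold Rdist in *. lra.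
Qed.

Lemma fun_metric_complete {I} (w : weight I) (P : (I -> C) -> Prop) :
  (forall (u : nat -> I -> C) f, (forall n, P (u n)) ->
     (forall eps, 0 < eps -> exists N, forall n, (N <= n)%nat -> wdist w (u n) f < eps) -> P f) ->
  complete (fun_metric w P).
Proof.
  intros HP u Hu.
  assert (Hc : forall i, exists z, forall eps, 0 < eps -> exists N, forall n, (N <= n)%nat ->
             Cmod (proj1_sig (u n) i - z) < eps).
  { intros i. apply C_complete. intros eps He. destruct (wdist_coord w i eps He) as [d [Hd H]].
    destruct (Hu d Hd) as [N HN]. exists N. intros p q Hp Hq. apply H. now apply HN. }
  set (f := fun i => proj1_sig (constructive_indefinite_description _ (Hc i))).
  assert (Hf : forall i eps, 0 < eps -> exists N, forall n, (N <= n)%nat ->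
             Cmod (proj1_sig (u n) i - f i) < eps).
  { intros i. unfold f. now destruct (constructive_indefinite_description _ (Hc i)). }
  assert (Hconv : forall eps, 0 < eps -> exists N, forall n, (N <= n)%nat ->
             wdist w (proj1_sig (u n)) f < eps).
  { intros eps He. destruct (wdist_small w eps He) as [l [d [Hd Hs]]].
    assert (Hl : exists N, forall n, (N <= n)%nat -> forall i, In i l ->
               Cmod (proj1_sig (u n) i - f i) < d).
    { clear Hs. induction l as [|i l [N IH]].
      - exists 0%nat. intros n _ i [].
      - destruct (Hf i d Hd) as [N' H']. exists (Nat.max N N'). intros n Hn j [<-|Hj].
        + apply H'. lia.
        + apply IH; [lia|exact Hj]. }
    destruct Hl as [N HN]. exists N. intros n Hn. apply Hs. now apply HN. }
  assert (Pf : P f) by (apply (HP (fun n => proj1_sig (u n))); [intros; apply proj2_sig|exact Hconv]).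
  exists (exist _ f Pf). exact Hconv.
Qed.

Lemma interval_tb (eps : R) : 0 < eps -> exists l : list (R -> Prop),
  (forall x, Rabs x <= 1 -> exists P, In P l /\ P x) /\
  (forall P x y, In P l -> P x -> P y -> Rabs (x - y) < eps).
Proof.
  intros He. destruct (archi_small eps He) as [N HN]. specialize (HN N (le_n N)).
  set (M := INR (S N)) in *. assert (HM : 0 < M) by (apply lt_0_INR; lia).
  set (cell := fun k : nat => fun x => INR k <= M * (x + 1) < INR k + 1).
  (* Cells have length [1 / M]; the last index [2 * S N] is there for [x = 1]. *)
  exists (map cell (seq 0 (2 * S N + 1))). split.
  - intros x Hx. assert (Hx' : -1 <= x <= 1) by (revert Hx; unfold Rabs; destruct Rcase_abs; lra).
    destruct (archimed (M * (x + 1))) as [A1 A2].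
    set (z := (up (M * (x + 1)) - 1)%Z).
    assert (Hz1 : IZR z <= M * (x + 1) < IZR z + 1) by (unfold z; rewrite minus_IZR; lra).
    assert (Hz0 : (0 <= z)%Z).
    { apply Z.lt_succ_r. apply lt_IZR. unfold Z.succ. rewrite plus_IZR. nra. }
    exists (cell (Z.to_nat z)).
    assert (E : INR (Z.to_nat z) = IZR z) by (rewrite INR_IZR_INZ, Z2Nat.id; auto).
    split.
    + apply in_map. apply in_seq. split; [lia|].
      assert (INR (Z.to_nat z) <= INR (2 * S N)).
      { rewrite E, mult_INR. fold M. simpl (INR 2). nra. }
      apply INR_le in H. lia.
    + unfold cell. rewrite E. exact Hz1.
  - intros P x y HP Px Py. apply in_map_iff in HP. destruct HP as [k [<- _]].
    unfold cell in Px, Py.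
    assert (H : Rabs (M * (x - y)) < 1).
    { apply Rabs_def1; lra. }
    rewrite Rabs_mult, (Rabs_pos_eq M) in H by lra.
    apply Rlt_trans with (/ M); [|exact HN].
    apply (Rmult_lt_reg_l M); [exact HM|]. rewrite Rinv_r by lra. exact H.
Qed.

(** Common refinement of two finite covers pulled back along [pa] and [pb]; it adds one coordinate
    at a time in the total boundedness proofs. *)
Lemma list_prod_preds {A B E : Type} (la : list (A -> Prop)) (lb : list (B -> Prop))
    (pa : E -> A) (pb : E -> B) :
  exists l : list (E -> Prop),
    (forall e P Q, In P la -> P (pa e) -> In Q lb -> Q (pb e) -> exists S, In S l /\ S e) /\
    (forall S, In S l -> exists P Q, In P la /\ In Q lb /\ forall e, S e -> P (pa e) /\ Q (pb e)).
Proof.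
  exists (map (fun p e => fst p (pa e) /\ snd p (pb e)) (list_prod la lb)). split.
  - intros e P Q HP HPe HQ HQe. exists (fun e => P (pa e) /\ Q (pb e)). split; [|auto].
    apply in_map_iff. exists (P, Q). split; [reflexivity|]. now apply in_prod.
  - intros S HS. apply in_map_iff in HS. destruct HS as [[P Q] [<- H]].
    apply in_prod_iff in H. exists P, Q. simpl. tauto.
Qed.

Lemma disk_tb (eps : R) : 0 < eps -> exists l : list (C -> Prop),
  (forall x, Cmod x <= 1 -> exists P, In P l /\ P x) /\
  (forall P x y, In P l -> P x -> P y -> Cmod (x - y) < eps).
Proof.
  intros He. destruct (interval_tb (eps / 2)) as [l [H1 H2]]; [lra|].
  destruct (list_prod_preds l l (fun z : C => fst z) (fun z : C => snd z)) as [l' [H3 H4]].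
  exists l'. split.
  - intros z Hz. destruct (H1 (fst z)) as [P [HP Pz]].
    { eapply Rle_trans; [apply re_le_Cmod|exact Hz]. }
    destruct (H1 (snd z)) as [Q [HQ Qz]].
    { eapply Rle_trans; [apply im_le_Cmod|exact Hz]. }
    exact (H3 z P Q HP Pz HQ Qz).
  - intros S x y HS Sx Sy. destruct (H4 S HS) as [P [Q [HP [HQ H]]]].
    apply H in Sx. apply H in Sy.
    assert (A : Rabs (fst x - fst y) < eps / 2) by (apply (H2 P); tauto).
    assert (B : Rabs (snd x - snd y) < eps / 2) by (apply (H2 Q); tauto).
    eapply Rle_lt_trans; [apply Cmod_le_re_im|].
    change (Rabs (fst x - fst y) + Rabs (snd x - snd y) < eps). lra.
Qed.

Lemma fun_metric_tb {I} (w : weight I) (P : (I -> C) -> Prop) :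
  (forall f, P f -> forall i, Cmod (f i) <= 1) -> totally_bounded (fun_metric w P).
Proof.
  intros HP eps He. destruct (wdist_small w eps He) as [l [d [Hd Hs]]].
  assert (Hl : exists L : list (fun_metric w P -> Prop),
            (forall x, exists Q, In Q L /\ Q x) /\
            (forall Q x y, In Q L -> Q x -> Q y ->
                forall i, In i l -> Cmod (proj1_sig x i - proj1_sig y i) < d)).
  { clear Hs. induction l as [|i l [L [IH1 IH2]]].
    - exists ((fun _ => True) :: nil). split.
      + intros x. exists (fun _ => True). split; [now left|exact Logic.I].
      + intros Q x y _ _ _ i [].
    - destruct (disk_tb d Hd) as [D [HD1 HD2]].
      destruct (list_prod_preds L D (fun x => x) (fun x : fun_metric w P => proj1_sig x i))
        as [L' [H3 H4]].
      exists L'. split.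
      + intros x. destruct (IH1 x) as [Q [HQ Qx]].
        destruct (HD1 (proj1_sig x i)) as [S [HS Sx]]; [apply HP, proj2_sig|].
        exact (H3 x Q S HQ Qx HS Sx).
      + intros S x y HS Sx Sy j Hj. destruct (H4 S HS) as [Q [T [HQ [HT H]]]].
        apply H in Sx. apply H in Sy. destruct Hj as [<-|Hj].
        * apply (HD2 T); tauto.
        * apply (IH2 Q); tauto. }
  destruct Hl as [L [H1 H2]]. exists L. split; [exact H1|].
  intros Q x y HQ Qx Qy. apply Hs. now apply (H2 Q).
Qed.

(** * Lifting paths from the circle *)

Definition cis (a : R) : C := (cos a, sin a).

Lemma C_ext (z w : C) : fst z = fst w -> snd z = snd w -> z = w.
Proof. destruct z, w. simpl. now intros -> ->. Qed.

Lemma cis_plus a b : cis (a + b) = (cis a * cis b)%C.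
Proof. apply C_ext; simpl; [rewrite cos_plus|rewrite sin_plus]; ring. Qed.

Lemma cis_0 : cis 0 = RtoC 1.
Proof. apply C_ext; simpl; [apply cos_0|apply sin_0]. Qed.

Lemma cis_opp a : cis (- a) = Cconj (cis a).
Proof. apply C_ext; simpl; [apply cos_neg|apply sin_neg]. Qed.

Lemma cis_mul_opp a : (cis a * cis (- a))%C = RtoC 1.
Proof. rewrite <- cis_plus, Rplus_opp_r. apply cis_0. Qed.

Lemma Cmod_cis a : Cmod (cis a) = 1.
Proof.
  unfold Cmod. simpl fst. simpl snd. rewrite <- sqrt_1. f_equal.
  pose proof (sin2_cos2 a). unfold Rsqr in H. simpl. lra.
Qed.

Lemma unit_re_im (z : C) : Cmod z = 1 -> fst z * fst z + snd z * snd z = 1.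
Proof.
  intros H. unfold Cmod in H.
  assert (E : sqrt (fst z ^ 2 + snd z ^ 2) * sqrt (fst z ^ 2 + snd z ^ 2) = 1) by (rewrite H; ring).
  rewrite sqrt_sqrt in E by nra. nra.
Qed.

Lemma unit_conj (z : C) : Cmod z = 1 -> (z * Cconj z)%C = RtoC 1.
Proof. intros H. apply unit_re_im in H. apply C_ext; simpl; nra. Qed.

Lemma unit_mul (z w : C) : Cmod z = 1 -> Cmod w = 1 -> Cmod (z * w) = 1.
Proof. intros Hz Hw. rewrite Cmod_mult, Hz, Hw. ring. Qed.

Lemma unit_Cconj (z : C) : Cmod z = 1 -> Cmod (Cconj z) = 1.
Proof. now rewrite Cmod_conj. Qed.

Lemma cis_surj (z : C) : Cmod z = 1 -> exists a, z = cis a.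
Proof.
  intros H. apply unit_re_im in H.
  assert (B : -1 <= fst z <= 1) by nra.
  assert (E : sin (acos (fst z)) = Rabs (snd z)).
  { rewrite sin_acos by exact B. rewrite <- sqrt_Rsqr_abs. f_equal. unfold Rsqr. lra. }
  destruct (Rle_dec 0 (snd z)) as [Hs|Hs].
  - exists (acos (fst z)). apply C_ext; simpl; [now rewrite cos_acos|].
    rewrite E, Rabs_pos_eq; auto.
  - exists (- acos (fst z)). apply C_ext; simpl; [now rewrite cos_neg, cos_acos|].
    rewrite sin_neg, E, Rabs_left; lra.
Qed.

Lemma cis_eq_1 a : cis a = RtoC 1 -> exists k : Z, a = 2 * PI * IZR k.
Proof.
  intros H. assert (Hc : cos a = 1) by (now injection H).
  replace a with (2 * (a / 2)) in Hc by field. rewrite cos_2a_sin in Hc.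
  assert (Hs : sin (a / 2) = 0) by nra.
  apply sin_eq_0_0 in Hs. destruct Hs as [k Hk]. exists k. lra.
Qed.

Lemma cis_2PI (k : Z) : cis (2 * PI * IZR k) = RtoC 1.
Proof.
  assert (Hs : sin (PI * IZR k) = 0) by (apply sin_eq_0_1; exists k; ring).
  apply C_ext; simpl; replace (2 * PI * IZR k) with (2 * (PI * IZR k)) by ring.
  - rewrite cos_2a_sin, Hs. ring.
  - rewrite sin_2a, Hs. ring.
Qed.

Lemma abs_sin_le x : Rabs (sin x) <= Rabs x.
Proof.
  assert (Hp : forall y, 0 <= y -> Rabs (sin y) <= y).
  { intros y Hy. destruct (Rle_dec y 1) as [H1|H1].
    - destruct Hy as [Hy|<-]; [|rewrite sin_0, Rabs_R0; lra].
      pose proof (sin_lt_x y Hy). pose proof PI_RGT_0. pose proof PI2_1.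
      rewrite Rabs_pos_eq; [lra|]. apply sin_ge_0; lra.
    - pose proof (SIN_bound y). apply Rabs_le. lra. }
  destruct (Rle_dec 0 x) as [H|H].
  - rewrite (Rabs_pos_eq x H). now apply Hp.
  - rewrite <- (Rabs_Ropp (sin x)), <- sin_neg, <- (Rabs_Ropp x), (Rabs_pos_eq (- x)) by lra.
    apply Hp. lra.
Qed.

Lemma cis_lip a b : Cmod (cis a - cis b) <= Rabs (a - b).
Proof.
  unfold Cmod. apply Rsqr_incr_0_var; [|apply Rabs_pos].
  rewrite Rsqr_sqrt by nra. rewrite <- Rsqr_abs. unfold Rsqr.
  change ((cos a - cos b) ^ 2 + (sin a - sin b) ^ 2 <= (a - b) * (a - b)).
  pose proof (sin2_cos2 a) as Ha. pose proof (sin2_cos2 b) as Hb. unfold Rsqr in *.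
  pose proof (cos_minus a b) as Hm.
  replace (a - b) with (2 * ((a - b) / 2)) in Hm by field. rewrite cos_2a_sin in Hm.
  pose proof (abs_sin_le ((a - b) / 2)) as Hs.
  assert (Hs2 : sin ((a - b) / 2) * sin ((a - b) / 2) <= ((a - b) / 2) * ((a - b) / 2)).
  { pose proof (Rsqr_le_abs_1 _ _ Hs). unfold Rsqr in H. exact H. }
  nra.
Qed.

Lemma cis_cont : mcont R_metric C_metric cis.
Proof.
  intros x eps He. exists eps. split; [exact He|]. intros y Hy. simpl in *.
  eapply Rle_lt_trans; [apply cis_lip|exact Hy].
Qed.

Lemma cont_at_const (M N : MetricSpace) (c : N) (x : M) : @cont_at M N (fun _ => c) x.
Proof. intros eps He. exists 1. split; [lra|]. intros. now rewrite dist_refl. Qed.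

Lemma cont_at_mul (M : MetricSpace) (f g : M -> C) (x : M) :
  (forall y, Cmod (f y) = 1) -> (forall y, Cmod (g y) = 1) ->
  @cont_at M C_metric f x -> @cont_at M C_metric g x ->
  @cont_at M C_metric (fun y => f y * g y)%C x.
Proof.
  intros Uf Ug Hf Hg eps He.
  destruct (Hf (eps / 2)) as [d1 [Hd1 H1]]; [lra|].
  destruct (Hg (eps / 2)) as [d2 [Hd2 H2]]; [lra|].
  exists (Rmin d1 d2). split; [now apply Rmin_pos|]. intros y Hy.
  assert (A1 : Cmod (f x - f y) < eps / 2).
  { apply H1. eapply Rlt_le_trans; [exact Hy|apply Rmin_l]. }
  assert (A2 : Cmod (g x - g y) < eps / 2).
  { apply H2. eapply Rlt_le_trans; [exact Hy|apply Rmin_r]. }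
  simpl. replace (f x * g x - f y * g y)%C with ((f x - f y) * g x + f y * (g x - g y))%C by ring.
  eapply Rle_lt_trans; [apply Cmod_triangle|]. rewrite !Cmod_mult, Uf, Ug. lra.
Qed.

Lemma cont_at_Cconj (M : MetricSpace) (f : M -> C) (x : M) :
  @cont_at M C_metric f x -> @cont_at M C_metric (fun y => Cconj (f y)) x.
Proof.
  intros Hf eps He. destruct (Hf eps He) as [d [Hd H]]. exists d. split; [exact Hd|].
  intros y Hy. simpl. replace (Cconj (f x) - Cconj (f y))%C with (Cconj (f x - f y)).
  - rewrite Cmod_conj. now apply H.
  - apply C_ext; simpl; ring.
Qed.

Lemma cont_at_inv (M : MetricSpace) (f : M -> R) (x : M) : f x <> 0 ->
  @cont_at M R_metric f x -> @cont_at M R_metric (fun y => / f y) x.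
Proof.
  intros Hx Hf.
  apply (cont_at_comp M R_metric R_metric f Rinv); [exact Hf|].
  intros eps He.
  destruct (continuity_pt_inv (fun r => r) (f x) (derivable_continuous_pt _ _ (derivable_pt_id _)) Hx eps He)
    as [d [Hd H]].
  exists d. split; [exact Hd|]. intros y Hy. simpl in *. unfold Rdist, inv_fct in H.
  destruct (Req_dec (f x) y) as [<-|Hne].
  - rewrite Rminus_diag, Rabs_R0. exact He.
  - rewrite Rabs_minus_sym. apply H. split; [split; [exact I|exact Hne]|].
    now rewrite Rabs_minus_sym.
Qed.

Lemma mcont_re (f : R -> C) : mcont R_metric C_metric f -> continuity (fun x => fst (f x)).
Proof.
  intros H. apply mcont_continuity. intros x eps He. destruct (H x eps He) as [d [Hd H']].
  exists d. split; [exact Hd|]. intros y Hy. eapply Rle_lt_trans; [|exact (H' y Hy)].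
  apply (re_le_Cmod (f x - f y)).
Qed.

Lemma mcont_im (f : R -> C) : mcont R_metric C_metric f -> continuity (fun x => snd (f x)).
Proof.
  intros H. apply mcont_continuity. intros x eps He. destruct (H x eps He) as [d [Hd H']].
  exists d. split; [exact Hd|]. intros y Hy. eapply Rle_lt_trans; [|exact (H' y Hy)].
  apply (im_le_Cmod (f x - f y)).
Qed.

Definition clamp (b u : R) : R := Rmax (- b) (Rmin b u).

Lemma clamp_id b u : Rabs u <= b -> clamp b u = u.
Proof.
  intros H. apply Rcomplements.Rabs_le_between in H. unfold clamp. rewrite Rmin_right by lra. rewrite Rmax_right; lra.
Qed.

Lemma clamp_bound b u : 0 <= b -> Rabs (clamp b u) <= b.
Proof.
  intros H. apply Rabs_le. unfold clamp, Rmax, Rmin.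
  destruct (Rle_dec b u); destruct Rle_dec; lra.
Qed.

Lemma clamp_lip b u v : Rabs (clamp b u - clamp b v) <= Rabs (u - v).
Proof.
  unfold clamp, Rmax, Rmin, Rabs.
  repeat (destruct Rle_dec || destruct Rcase_abs); lra.
Qed.

Lemma clamp_close b d u : 0 <= b -> 0 <= d -> Rabs u <= b + d -> Rabs (u - clamp b u) <= d.
Proof.
  intros Hb Hd H. apply Rcomplements.Rabs_le_between in H. apply Rabs_le.
  unfold clamp, Rmax, Rmin. destruct (Rle_dec b u); destruct Rle_dec; lra.
Qed.

Lemma clamp_cont b : mcont R_metric R_metric (clamp b).
Proof.
  intros x eps He. exists eps. split; [exact He|]. intros y Hy.
  eapply Rle_lt_trans; [apply clamp_lip|exact Hy].
Qed.

Lemma cis_atan (z : C) : Cmod z = 1 -> 0 < fst z -> z = cis (atan (snd z / fst z)).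
Proof.
  intros H Hp. apply unit_re_im in H.
  assert (E : sqrt (1 + (snd z / fst z)²) = / fst z).
  { apply sqrt_lem_1.
    - pose proof (Rle_0_sqr (snd z / fst z)). lra.
    - left. now apply Rinv_0_lt_compat.
    - unfold Rsqr. apply (Rmult_eq_reg_r (fst z * fst z)); [|nra]. field_simplify; [|lra|lra]. nra. }
  apply C_ext; simpl; [rewrite cos_atan|rewrite sin_atan]; rewrite E; field; lra.
Qed.

Lemma unit_near_1 (z : C) : Cmod (z - RtoC 1) < 1 -> 0 < fst z.
Proof.
  intros H. pose proof (re_le_Cmod (z - RtoC 1)) as H'. simpl in H'.
  apply Rcomplements.Rabs_le_between in H'. lra.
Qed.

(* Each step extends the lift by [d] on both sides, adding the (small) argument of
   [g u / g (clamp u)] taken in the right half plane. *)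
Lemma circle_lift_uniform (g : R -> C) (d : R) :
  0 < d -> (forall u, Cmod (g u) = 1) -> g 0 = RtoC 1 -> mcont R_metric C_metric g ->
  (forall u v, Rabs (u - v) <= d -> Cmod (g u - g v) < 1) ->
  forall j : nat, exists th : R -> R, mcont R_metric R_metric th /\ th 0 = 0 /\
    forall u, Rabs u <= INR j * d -> g u = cis (th u).
Proof.
  intros Hd Ug g0 Cg Hg. induction j as [|j [th [C0 [Z0 IH]]]].
  - exists (fun _ => 0). split; [|split; [reflexivity|]].
    + intros x. apply (cont_at_const R_metric R_metric).
    + intros u Hu. simpl in Hu. rewrite Rmult_0_l in Hu.
      assert (u = 0).
      { apply NNPP. intros H. apply Rabs_pos_lt in H. lra. }
      subst u. now rewrite g0, cis_0.
  - set (b := INR j * d) in *. set (b' := INR (S j) * d).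
    assert (Hb' : b' = b + d) by (unfold b', b; rewrite S_INR; ring).
    assert (Hb : 0 <= b) by (unfold b; pose proof (pos_INR j); nra).
    set (q := fun u => (g (clamp b' u) * Cconj (g (clamp b u)))%C).
    assert (Uq : forall u, Cmod (q u) = 1).
    { intros u. unfold q. apply unit_mul; [apply Ug|]. apply unit_Cconj, Ug. }
    assert (Hq : forall u, 0 < fst (q u)).
    { intros u. apply unit_near_1. unfold q.
      replace (RtoC 1) with (g (clamp b u) * Cconj (g (clamp b u)))%C by (now apply unit_conj).
      replace (g (clamp b' u) * Cconj (g (clamp b u)) - g (clamp b u) * Cconj (g (clamp b u)))%C
        with ((g (clamp b' u) - g (clamp b u)) * Cconj (g (clamp b u)))%C by ring.
      rewrite Cmod_mult, unit_Cconj, Rmult_1_r by apply Ug. apply Hg.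
      assert (E : clamp b u = clamp b (clamp b' u)).
      { unfold clamp, Rmax, Rmin. repeat destruct Rle_dec; lra. }
      rewrite E. apply clamp_close; [exact Hb|lra|]. rewrite <- Hb'. apply clamp_bound. lra. }
    assert (Cq : mcont R_metric C_metric q).
    { intros u. apply (cont_at_mul R_metric); try (intros; apply Ug).
      - intros y. apply unit_Cconj, Ug.
      - apply (cont_at_comp R_metric R_metric C_metric (clamp b') g); [apply clamp_cont|apply Cg].
      - apply (cont_at_Cconj R_metric (fun u => g (clamp b u))).
        apply (cont_at_comp R_metric R_metric C_metric (clamp b) g); [apply clamp_cont|apply Cg]. }
    exists (fun u => th (clamp b u) + atan (snd (q u) / fst (q u))). split; [|split].
    + apply mcont_continuity. apply (continuity_plus (fun u => th (clamp b u))).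
      * apply mcont_continuity. exact (mcont_comp R_metric R_metric R_metric _ _ (clamp_cont b) C0).
      * apply (continuity_comp (fun u => snd (q u) / fst (q u)) atan).
        -- apply (continuity_div (fun u => snd (q u)) (fun u => fst (q u))).
           ++ now apply mcont_im.
           ++ now apply mcont_re.
           ++ intros u. specialize (Hq u). lra.
        -- intros x. apply derivable_continuous_pt, derivable_pt_atan.
    + assert (E : q 0 = RtoC 1).
      { unfold q. rewrite !clamp_id by (rewrite Rabs_R0; lra). rewrite g0. apply C_ext; simpl; ring. }
      rewrite E, clamp_id, Z0 by (rewrite Rabs_R0; lra). simpl.
      unfold Rdiv. rewrite Rmult_0_l, atan_0. ring.
    + intros u Hu. rewrite cis_plus, <- cis_atan by auto.
      rewrite <- IH by (now apply clamp_bound). unfold q.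
      rewrite (clamp_id b' u) by exact Hu.
      replace (g (clamp b u) * (g u * Cconj (g (clamp b u))))%C
        with (g u * (g (clamp b u) * Cconj (g (clamp b u))))%C by ring.
      rewrite unit_conj by apply Ug. ring.
Qed.

Lemma path_unif_cont (g : R -> C) (b : R) : 0 <= b -> mcont R_metric C_metric g ->
  exists d, 0 < d /\ forall u v, Rabs (u - v) <= d -> Cmod (g (clamp b u) - g (clamp b v)) < 1.
Proof.
  intros Hb Cg.
  assert (Hu : forall f, continuity f -> exists d, 0 < d /\ forall u v, Rabs (u - v) <= d ->
             Rabs (f (clamp b u) - f (clamp b v)) < / 2).
  { intros f Cf. assert (H2 : 0 < / 2) by lra.
    destruct (Heine f (fun x => - b <= x <= b) (compact_P3 _ _) (fun x _ => Cf x) (mkposreal _ H2))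
      as [[d Hd] H]. simpl in H.
    exists (d / 2). split; [lra|]. intros u v Huv. apply H.
    - apply Rcomplements.Rabs_le_between. now apply clamp_bound.
    - apply Rcomplements.Rabs_le_between. now apply clamp_bound.
    - pose proof (clamp_lip b u v). lra. }
  destruct (Hu _ (mcont_re g Cg)) as [d1 [Hd1 H1]].
  destruct (Hu _ (mcont_im g Cg)) as [d2 [Hd2 H2]].
  exists (Rmin d1 d2). split; [now apply Rmin_pos|]. intros u v Huv.
  eapply Rle_lt_trans; [apply Cmod_le_re_im|].
  assert (A : Rabs (u - v) <= d1) by (eapply Rle_trans; [exact Huv|apply Rmin_l]).
  assert (B : Rabs (u - v) <= d2) by (eapply Rle_trans; [exact Huv|apply Rmin_r]).
  specialize (H1 _ _ A). specialize (H2 _ _ B). simpl.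
  unfold Rminus in *. lra.
Qed.

(** The lift is restricted to a compact interval because the extension by steps of fixed length
    needs uniform continuity; composing with [clamp b] provides it on the whole line. *)
Lemma circle_lift (g : R -> C) (b : R) :
  0 <= b -> (forall u, Cmod (g u) = 1) -> g 0 = RtoC 1 -> mcont R_metric C_metric g ->
  exists th : R -> R, mcont R_metric R_metric th /\ th 0 = 0 /\
    forall u, Rabs u <= b -> g u = cis (th u).
Proof.
  intros Hb Ug g0 Cg. destruct (path_unif_cont g b Hb Cg) as [d [Hd H]].
  destruct (INR_unbounded (b / d)) as [j Hj].
  destruct (circle_lift_uniform (fun u => g (clamp b u)) d Hd) with (j := j) as [th [Ct [Z0 Ht]]].
  - intros u. apply Ug.
  - rewrite clamp_id; [exact g0|rewrite Rabs_R0; exact Hb].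
  - exact (mcont_comp R_metric R_metric C_metric _ _ (clamp_cont b) Cg).
  - exact H.
  - exists th. split; [exact Ct|]. split; [exact Z0|]. intros u Hu.
    rewrite <- Ht, clamp_id; auto. eapply Rle_trans; [exact Hu|].
    assert (b < INR j * d); [|lra].
    apply (Rmult_lt_reg_r (/ d)); [now apply Rinv_0_lt_compat|].
    rewrite Rmult_assoc, Rinv_r by lra. rewrite Rmult_1_r. exact Hj.
Qed.

Lemma C_square_1 (z : C) : (z * z)%C = RtoC 1 -> z = RtoC 1 \/ z = RtoC (-1).
Proof.
  intros H. assert (E : ((z - RtoC 1) * (z + RtoC 1))%C = RtoC 0).
  { replace ((z - RtoC 1) * (z + RtoC 1))%C with (z * z - RtoC 1)%C by (apply C_ext; simpl; ring).
    rewrite H. ring. }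
  assert (E' : Cmod (z - RtoC 1) * Cmod (z + RtoC 1) = 0) by (rewrite <- Cmod_mult, E; apply Cmod_0).
  apply Rmult_integral in E'. destruct E' as [E'|E']; apply Cmod_eq_0 in E'.
  - left. replace z with (z - RtoC 1 + RtoC 1)%C by ring. rewrite E'. ring.
  - right. replace z with (z + RtoC 1 - RtoC 1)%C by ring. rewrite E'. apply C_ext; simpl; ring.
Qed.

(** A continuous path in [{1, -1}] is constant. This decides between the two square roots when a
    lift passes from coordinate [k] of the solenoid to coordinate [k + 1]. *)
Lemma square_1_path (c : R -> C) : mcont R_metric C_metric c -> c 0 = RtoC 1 ->
  (forall u, (c u * c u)%C = RtoC 1) -> forall u, c u = RtoC 1.
Proof.
  intros Cc c0 Hc u. destruct (C_square_1 _ (Hc u)) as [H|H]; [exact H|exfalso].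
  assert (Cr : mcont R_metric R_metric (fun x => fst (c x))).
  { apply mcont_continuity. now apply mcont_re. }
  assert (E0 : fst (c 0) = 1) by (now rewrite c0).
  assert (Eu : fst (c u) = -1) by (now rewrite H).
  assert (Hz : exists z, fst (c z) = 0).
  { destruct (Rle_dec 0 u) as [Hu|Hu].
    - destruct (IVT_value _ 0 u 0 Cr Hu) as [z [_ Hz]]; [lra|]. now exists z.
    - destruct (IVT_value _ u 0 0 Cr) as [z [_ Hz]]; [lra|lra|]. now exists z. }
  destruct Hz as [z Hz]. destruct (C_square_1 _ (Hc z)) as [Hz'|Hz']; rewrite Hz' in Hz; simpl in Hz; lra.
Qed.

(** * The dyadic solenoid *)

(** The inverse limit of the unit circle under squaring, a compact abelian group under the
    coordinatewise product. *)
Definition solenoid (x : nat -> C) : Prop :=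
  (forall k, Cmod (x k) = 1) /\ forall k, x k = (x (S k) * x (S k))%C.

(* Any speed that is an irrational multiple of [2 * PI] would do: it makes the
   time-one map of [flow] minimal. *)
Definition tau : R := 2 * PI * sqrt 2.

(** Translation by a one-parameter subgroup; the angle is halved from one coordinate to the next so
    that squaring is respected. *)
Definition flow (x : nat -> C) (s : R) (k : nat) : C := (x k * cis (tau * s / 2 ^ k))%C.

Definition sone (k : nat) : C := RtoC 1.

Definition iota (s : R) : nat -> C := flow sone s.

(** Group inversion, the coordinates being unit numbers: the [- x] of the overview. *)
Definition sconj (x : nat -> C) (k : nat) : C := Cconj (x k).

Lemma tau_pos : 0 < tau.
Proof.
  unfold tau. pose proof PI_RGT_0. pose proof (sqrt_lt_R0 2). nra.
Qed.

Lemma pow2_pos k : 0 < 2 ^ k.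
Proof. apply pow_lt. lra. Qed.

Lemma solenoid_one : solenoid sone.
Proof. split; intros; unfold sone; [apply Cmod_1|]. ring. Qed.

Lemma solenoid_flow x s : solenoid x -> solenoid (flow x s).
Proof.
  intros [U H]. split; intros k; unfold flow.
  - apply unit_mul; [apply U|apply Cmod_cis].
  - replace (tau * s / 2 ^ k) with (tau * s / 2 ^ S k + tau * s / 2 ^ S k).
    + rewrite cis_plus, (H k). ring.
    + simpl. field. apply pow_nonzero. lra.
Qed.

Lemma solenoid_iota s : solenoid (iota s).
Proof. apply solenoid_flow, solenoid_one. Qed.

Lemma solenoid_conj x : solenoid x -> solenoid (sconj x).
Proof.
  intros [U H]. split; intros k; unfold sconj.
  - apply unit_Cconj, U.
  - rewrite (H k). apply C_ext; simpl; ring.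
Qed.

Lemma flow_0 x : flow x 0 = x.
Proof.
  apply functional_extensionality. intros k. unfold flow.
  replace (tau * 0 / 2 ^ k) with 0 by (field; apply pow_nonzero; lra). rewrite cis_0. ring.
Qed.

Lemma flow_add x s r : flow (flow x s) r = flow x (s + r).
Proof.
  apply functional_extensionality. intros k. unfold flow.
  replace (tau * (s + r) / 2 ^ k) with (tau * s / 2 ^ k + tau * r / 2 ^ k)
    by (field; apply pow_nonzero; lra).
  rewrite cis_plus. ring.
Qed.

Lemma flow_iota s r : flow (iota s) r = iota (s + r).
Proof. apply flow_add. Qed.

Lemma iota_0 : iota 0 = sone.
Proof. apply flow_0. Qed.

Lemma flow_cancel x y s : flow x s = flow y s -> x = y.
Proof.
  intros H. rewrite <- (flow_0 x), <- (flow_0 y), <- (Rplus_opp_r s), <- !flow_add, H. reflexivity.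
Qed.

Lemma sconj_flow x s : sconj (flow x s) = flow (sconj x) (- s).
Proof.
  apply functional_extensionality. intros k. unfold sconj, flow.
  replace (tau * - s / 2 ^ k) with (- (tau * s / 2 ^ k)) by (field; apply pow_nonzero; lra).
  rewrite cis_opp. apply C_ext; simpl; ring.
Qed.

Lemma sconj_one : sconj sone = sone.
Proof. apply functional_extensionality. intros k. apply C_ext; simpl; ring. Qed.

Lemma sconj_iota s : sconj (iota s) = iota (- s).
Proof. unfold iota. rewrite sconj_flow, sconj_one. reflexivity. Qed.

Lemma sconj_sconj x : sconj (sconj x) = x.
Proof. apply functional_extensionality. intros k. apply C_ext; simpl; ring. Qed.

(** Equal points would make [tau * (s - r) / 2 ^ k] a multiple of [2 * PI] for every [k]; for large
    [k] it is nonzero and too small. Time along a leaf is therefore well defined. *)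
Lemma flow_inj x s r : solenoid x -> flow x s = flow x r -> s = r.
Proof.
  intros [U _] H. apply NNPP. intros Hne.
  assert (Hc : forall k, cis (tau * (s - r) / 2 ^ k) = RtoC 1).
  { intros k. assert (E : flow x s k = flow x r k) by now rewrite H. unfold flow in E.
    assert (E' : cis (tau * s / 2 ^ k) = cis (tau * r / 2 ^ k)).
    { pose proof (unit_conj _ (U k)) as Hx.
      replace (cis (tau * s / 2 ^ k)) with (x k * Cconj (x k) * cis (tau * s / 2 ^ k))%C
        by (rewrite Hx; ring).
      replace (x k * Cconj (x k) * cis (tau * s / 2 ^ k))%C
        with (Cconj (x k) * (x k * cis (tau * s / 2 ^ k)))%C by ring.
      rewrite E.
      replace (Cconj (x k) * (x k * cis (tau * r / 2 ^ k)))%C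
        with (x k * Cconj (x k) * cis (tau * r / 2 ^ k))%C by ring.
      rewrite Hx. ring. }
    replace (tau * (s - r) / 2 ^ k) with (tau * s / 2 ^ k + - (tau * r / 2 ^ k))
      by (field; apply pow_nonzero; lra).
    rewrite cis_plus, E'. apply cis_mul_opp. }
  destruct (Pow_x_infinity 2) with (b := tau * Rabs (s - r)) as [N HN].
  { rewrite Rabs_pos_eq; lra. }
  specialize (HN N (le_n N)). rewrite Rabs_pos_eq in HN by (left; apply pow2_pos).
  destruct (cis_eq_1 _ (Hc N)) as [k Hk].
  pose proof tau_pos. pose proof (pow2_pos N) as Hp.
  assert (Hk0 : k <> 0%Z).
  { intros ->. rewrite Rmult_0_r in Hk. apply Rmult_integral in Hk. destruct Hk as [Hk|Hk].
    - apply Rmult_integral in Hk. destruct Hk; lra.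
    - apply (Rinv_neq_0_compat (2 ^ N)); [lra|exact Hk]. }
  assert (Habs : 1 <= Rabs (IZR k)).
  { rewrite <- abs_IZR. apply (IZR_le 1). lia. }
  assert (E : tau * (s - r) = 2 * PI * IZR k * 2 ^ N).
  { rewrite <- Hk. field. lra. }
  assert (E2 : tau * Rabs (s - r) = 2 * PI * Rabs (IZR k) * 2 ^ N).
  { rewrite <- (Rabs_pos_eq tau), <- Rabs_mult, E, !Rabs_mult by lra.
    pose proof PI_RGT_0.
    rewrite (Rabs_pos_eq 2), (Rabs_pos_eq PI), (Rabs_pos_eq (2 ^ N)) by lra. reflexivity. }
  pose proof PI2_1.
  assert (2 ^ N * 1 < 2 ^ N * (2 * PI * Rabs (IZR k))) by (apply Rmult_lt_compat_l; nra).
  lra.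
Qed.

Lemma iota_inj s r : iota s = iota r -> s = r.
Proof. apply flow_inj, solenoid_one. Qed.

(** * The metric of the solenoid *)

Definition nat_weight : weight nat.
Proof.
  refine (Build_weight nat (fun k => / 2 ^ k) _ _ _).
  - intros k. apply Rinv_0_lt_compat, pow2_pos.
  - intros k. rewrite <- Rinv_1. apply Rinv_le_contravar; [lra|]. apply pow_R1_Rle. lra.
  - intros eps He. destruct (Pow_x_infinity 2) with (b := / eps + 1) as [N HN].
    { rewrite Rabs_pos_eq; lra. }
    exists (seq 0 N). intros k. destruct (le_lt_dec N k) as [Hk|Hk].
    + right. specialize (HN k Hk). rewrite Rabs_pos_eq in HN by (left; apply pow2_pos).
      rewrite <- (Rinv_inv eps). apply Rinv_lt_contravar; [|lra].
      pose proof (Rinv_0_lt_compat _ He). pose proof (pow2_pos k). nra.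
    + left. apply in_seq. lia.
Defined.

Definition rho (x : nat -> C) : R := wdist nat_weight x sone.

Lemma rho_ge0 x : 0 <= rho x.
Proof. apply wdist_ge0. Qed.

Lemma rho_eq0 x : rho x = 0 -> x = sone.
Proof. apply wdist_eq0. Qed.

Lemma rho_one : rho sone = 0.
Proof. apply wdist_refl. Qed.

Lemma rho_conj x : rho (sconj x) = rho x.
Proof.
  apply wdist_ext. intros k. unfold sconj.
  replace (Cconj (x k) - sone k)%C with (Cconj (x k - sone k)) by (apply C_ext; simpl; ring).
  apply Cmod_conj.
Qed.

(** Translations are isometries, so neighbourhoods of [iota m] reduce to those of [iota 0]. *)
Lemma wdist_flow x y s : wdist nat_weight (flow x s) (flow y s) = wdist nat_weight x y.
Proof.
  apply wdist_ext. intros k. unfold flow.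
  replace (x k * cis (tau * s / 2 ^ k) - y k * cis (tau * s / 2 ^ k))%C
    with ((x k - y k) * cis (tau * s / 2 ^ k))%C by ring.
  rewrite Cmod_mult, Cmod_cis. ring.
Qed.

Lemma cont_at_wdist (M : MetricSpace) {I} (w : weight I) (f : M -> I -> C) (z : I -> C) (x : M) :
  (forall i, @cont_at M C_metric (fun y => f y i) x) ->
  @cont_at M R_metric (fun y => wdist w (f y) z) x.
Proof.
  intros H eps He.
  assert (H' : @cont_at M (fun_metric w (fun _ => True)) (fun y => exist _ (f y) Logic.I) x).
  { apply cont_at_into_fun. exact H. }
  destruct (H' eps He) as [d [Hd Hx]]. exists d. split; [exact Hd|].
  intros y Hy. specialize (Hx y Hy). simpl in *.
  pose proof (wdist_tri w (f x) (f y) z). pose proof (wdist_tri w (f y) (f x) z).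
  rewrite (wdist_sym w (f y) (f x)) in H1. apply Rabs_def1; lra.
Qed.

Lemma cont_at_rho (M : MetricSpace) (f : M -> nat -> C) (x : M) :
  (forall k, @cont_at M C_metric (fun y => f y k) x) ->
  @cont_at M R_metric (fun y => rho (f y)) x.
Proof. apply (cont_at_wdist M nat_weight). Qed.

Lemma cont_at_scale (M : MetricSpace) (f : M -> R) (a : R) (x : M) :
  @cont_at M R_metric f x -> @cont_at M R_metric (fun y => a * f y) x.
Proof.
  intros Hf. apply (cont_at_comp M R_metric R_metric f (fun r => a * r)); [exact Hf|].
  apply mcont_continuity. apply (continuity_scal (fun r => r)).
  apply derivable_continuous, derivable_id.
Qed.

Lemma cont_at_cis (M : MetricSpace) (f : M -> R) (x : M) :
  @cont_at M R_metric f x -> @cont_at M C_metric (fun y => cis (f y)) x.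
Proof. intros Hf. apply (cont_at_comp M R_metric C_metric f cis); [exact Hf|apply cis_cont]. Qed.

Lemma cont_at_flow (M : MetricSpace) (f : M -> nat -> C) (h : M -> R) k (x : M) :
  (forall y, Cmod (f y k) = 1) ->
  @cont_at M C_metric (fun y => f y k) x -> @cont_at M R_metric h x ->
  @cont_at M C_metric (fun y => flow (f y) (h y) k) x.
Proof.
  intros U Hf Hh. apply (cont_at_mul M (fun y => f y k) (fun y => cis (tau * h y / 2 ^ k))).
  - exact U.
  - intros. apply Cmod_cis.
  - exact Hf.
  - apply cont_at_cis.
    assert (E : (fun y => tau * h y / 2 ^ k) = (fun y => tau / 2 ^ k * h y)).
    { apply functional_extensionality. intros y. field. apply pow_nonzero. lra. }
    rewrite E. now apply cont_at_scale.
Qed.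

(** * Paths in the solenoid run along leaves *)

(** Coordinate [0] is a path on the circle and lifts to an angle [ph]. Each further coordinate is a
    square root of the preceding one, so it differs from the translate by that angle at most by a
    sign, which continuity fixes at its value for [u = 0]. *)
Lemma solenoid_path_compact (g : R -> nat -> C) (b : R) : 0 <= b ->
  (forall u, solenoid (g u)) -> (forall k, mcont R_metric C_metric (fun u => g u k)) ->
  exists th : R -> R, mcont R_metric R_metric th /\ th 0 = 0 /\
    forall u, Rabs u <= b -> g u = flow (g 0) (th u).
Proof.
  intros Hb Sg Cg. pose proof tau_pos as Ht.
  assert (U : forall u k, Cmod (g u k) = 1) by (intros; apply Sg).
  destruct (circle_lift (fun u => g u 0%nat * Cconj (g 0 0%nat))%C b Hb) as [ph [Cp [P0 Hp]]].
  - intros u. apply unit_mul; [apply U|apply unit_Cconj, U].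
  - apply unit_conj, U.
  - intros u. apply (cont_at_mul R_metric (fun u => g u 0%nat) (fun _ => Cconj (g 0 0%nat))).
    + intros; apply U.
    + intros; apply unit_Cconj, U.
    + apply Cg.
    + apply (cont_at_const R_metric C_metric).
  - set (p := fun u => ph (clamp b u)).
    assert (Cp' : mcont R_metric R_metric p).
    { exact (mcont_comp R_metric R_metric R_metric _ _ (clamp_cont b) Cp). }
    assert (E0 : clamp b 0 = 0) by (apply clamp_id; rewrite Rabs_R0; exact Hb).
    (* Quotient of the actual coordinate by the one predicted from the angle, to be shown equal to
       [1]. *)
    set (c := fun k u => (g (clamp b u) k * (Cconj (g 0 k) * cis (- / 2 ^ k * p u)))%C).
    assert (Cc : forall k, mcont R_metric C_metric (c k)).
    { intros k u. apply (cont_at_mul R_metric (fun u => g (clamp b u) k)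
                           (fun u => Cconj (g 0 k) * cis (- / 2 ^ k * p u))%C).
      - intros; apply U.
      - intros; apply unit_mul; [apply unit_Cconj, U|apply Cmod_cis].
      - exact (mcont_comp R_metric R_metric C_metric _ _ (clamp_cont b) (Cg k) u).
      - apply (cont_at_mul R_metric (fun _ => Cconj (g 0 k))).
        + intros; apply unit_Cconj, U.
        + intros; apply Cmod_cis.
        + apply (cont_at_const R_metric C_metric).
        + apply (cont_at_cis R_metric). apply (cont_at_scale R_metric). apply Cp'. }
    assert (Hc : forall k u, c k u = RtoC 1).
    { induction k as [|k IH].
      - intros u. unfold c. simpl pow. replace (- / 1 * p u) with (- p u) by field.
        rewrite Cmult_assoc. rewrite Hp by now apply clamp_bound. apply cis_mul_opp.
      - apply square_1_path; [apply Cc| |].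
        + unfold c, p. rewrite E0, P0, Rmult_0_r, cis_0.
          replace (g 0 (S k) * (Cconj (g 0 (S k)) * 1))%C with (g 0 (S k) * Cconj (g 0 (S k)))%C by ring.
          apply unit_conj, U.
        + intros u. rewrite <- (IH u). unfold c.
          rewrite (proj2 (Sg (clamp b u)) k), (proj2 (Sg 0) k).
          replace (- / 2 ^ k * p u) with (- / 2 ^ S k * p u + - / 2 ^ S k * p u)
            by (simpl; field; apply pow_nonzero; lra).
          rewrite cis_plus, Cmult_conj. ring. }
    exists (fun u => / tau * p u). split; [|split].
    + intros u. apply (cont_at_scale R_metric). apply Cp'.
    + unfold p. rewrite E0, P0. ring.
    + intros u Hu. apply functional_extensionality. intros k. unfold flow.
      replace (tau * (/ tau * p u) / 2 ^ k) with (/ 2 ^ k * p u)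
        by (pose proof (pow2_pos k); field; lra).
      specialize (Hc k u). unfold c in Hc. rewrite clamp_id in Hc by exact Hu.
      replace (g u k) with (g u k * (g 0 k * Cconj (g 0 k)) * (cis (/ 2 ^ k * p u) * cis (- (/ 2 ^ k * p u))))%C.
      * replace (- (/ 2 ^ k * p u)) with (- / 2 ^ k * p u) by ring.
        replace (g u k * (g 0 k * Cconj (g 0 k)) * (cis (/ 2 ^ k * p u) * cis (- / 2 ^ k * p u)))%C
          with (g 0 k * cis (/ 2 ^ k * p u) * (g u k * (Cconj (g 0 k) * cis (- / 2 ^ k * p u))))%C by ring.
        rewrite Hc. ring.
      * rewrite unit_conj by apply U. rewrite cis_mul_opp. ring.
Qed.

(** Lifts on larger and larger intervals agree where both are valid, by [flow_inj], and so glue. *)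
Lemma solenoid_path (g : R -> nat -> C) :
  (forall u, solenoid (g u)) -> (forall k, mcont R_metric C_metric (fun u => g u k)) ->
  exists th : R -> R, mcont R_metric R_metric th /\ th 0 = 0 /\ forall u, g u = flow (g 0) (th u).
Proof.
  intros Sg Cg.
  assert (H : forall n : nat, exists th : R -> R, mcont R_metric R_metric th /\ th 0 = 0 /\
            forall u, Rabs u <= INR n -> g u = flow (g 0) (th u)).
  { intros n. apply solenoid_path_compact; auto. apply pos_INR. }
  set (th := fun n => proj1_sig (constructive_indefinite_description _ (H n))).
  assert (Hth : forall n, mcont R_metric R_metric (th n) /\ th n 0 = 0 /\
            forall u, Rabs u <= INR n -> g u = flow (g 0) (th n u)).
  { intros n. unfold th. now destruct (constructive_indefinite_description _ (H n)). }
  assert (HN : forall u, exists n, Rabs u <= INR n).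
  { intros u. destruct (INR_unbounded (Rabs u)) as [n Hn]. exists n. lra. }
  set (N := fun u => proj1_sig (constructive_indefinite_description _ (HN u))).
  assert (HN' : forall u, Rabs u <= INR (N u)).
  { intros u. unfold N. now destruct (constructive_indefinite_description _ (HN u)). }
  exists (fun u => th (N u) u). split; [|split].
  - intros u. destruct (HN (Rabs u + 1)) as [n Hn].
    assert (Hn' : Rabs u + 1 <= INR n) by (pose proof (Rle_abs (Rabs u + 1)); lra).
    apply (cont_at_ext_near R_metric R_metric _ (th n) u 1); [lra| |apply Hth].
    intros v Hv. simpl in Hv. apply (flow_inj (g 0)); [apply Sg|].
    destruct (Hth n) as [_ [_ E]]. rewrite <- E.
    + destruct (Hth (N v)) as [_ [_ E']]. symmetry. apply E', HN'.
    + replace v with (u - (u - v)) by ring. unfold Rminus at 1.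
      eapply Rle_trans; [apply Rabs_triang|]. rewrite Rabs_Ropp. lra.
  - apply Hth.
  - intros u. apply Hth. apply HN'.
Qed.

(** * Density of orbits by Diophantine approximation *)

(** Infinite descent: [p] is even, and [(p, q)] is replaced by [(q, p / 2)], under a bound on the
    absolute value of the first entry. *)
Lemma sqrt2_irrational (p q : Z) : sqrt 2 * IZR q = IZR p -> q = 0%Z.
Proof.
  intros H.
  assert (E : (p * p = 2 * (q * q))%Z).
  { apply eq_IZR. rewrite !mult_IZR, <- H.
    replace (sqrt 2 * IZR q * (sqrt 2 * IZR q)) with (sqrt 2 * sqrt 2 * (IZR q * IZR q)) by ring.
    rewrite sqrt_sqrt; lra. }
  clear H.
  assert (D : forall n p q : Z, (0 <= n)%Z -> (Z.abs p <= n)%Z -> (p * p = 2 * (q * q))%Z -> q = 0%Z).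
  { intros n p' q' Hn. revert p' q'. pattern n. apply Zlt_0_ind; [|exact Hn].
    clear n Hn. intros n IH _ p' q' Hp E'.
    destruct (Z.Even_or_Odd p') as [[r Hr]|[r Hr]]; [|subst p'; lia].
    subst p'. assert (E2 : (q' * q' = 2 * (r * r))%Z) by lia.
    destruct (Z.eq_dec q' 0) as [Hq|Hq]; [exact Hq|].
    assert (Hr : r <> 0%Z) by (intros ->; nia).
    assert (Hlt : (Z.abs q' < Z.abs (2 * r))%Z).
    { apply Z.square_lt_simpl_nonneg; [lia|]. rewrite <- !Z.abs_mul, !Z.abs_eq by nia. nia. }
    assert (r = 0%Z); [|contradiction].
    apply (IH (n - 1)%Z) with (p' := q'); [lia|lia|exact E2]. }
  exact (D (Z.abs p) p q (Z.abs_nonneg p) (Z.le_refl _) E).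
Qed.

(** Two fractional parts of multiples of [a] close to a common cluster point differ by little, and
    their difference is again a multiple of [a] up to an integer. *)
Lemma dirichlet_small (a eps : R) : 0 < eps ->
  exists (n : nat) (p : Z), (1 <= n)%nat /\ Rabs (INR n * a - IZR p) < eps.
Proof.
  intros He. set (u := fun n => INR n * a - IZR (Int_part (INR n * a))).
  destruct (Bolzano_Weierstrass u (fun x => 0 <= x <= 1)) as [l Hl].
  - apply compact_P3.
  - intros n. unfold u. destruct (base_Int_part (INR n * a)). lra.
  - assert (Hnb : neighbourhood (disc l (mkposreal (eps / 2) ltac:(lra))) l).
    { exists (mkposreal (eps / 2) ltac:(lra)). intros x Hx. exact Hx. }
    destruct (Hl _ 0%nat Hnb) as [n [_ Hn]]. destruct (Hl _ (S n) Hnb) as [m [Hm Hm']].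
    unfold disc in Hn, Hm'. simpl in Hn, Hm'.
    exists (m - n)%nat, (Int_part (INR m * a) - Int_part (INR n * a))%Z. split; [lia|].
    rewrite minus_INR by lia. rewrite minus_IZR.
    replace ((INR m - INR n) * a - (IZR (Int_part (INR m * a)) - IZR (Int_part (INR n * a))))
      with ((u m - l) - (u n - l)) by (unfold u; ring).
    unfold Rminus at 1. eapply Rle_lt_trans; [apply Rabs_triang|]. rewrite Rabs_Ropp. lra.
Qed.

Lemma multiples_dense (b x : R) (N : nat) : 0 < b ->
  exists (j : nat) (P : Z), (N <= j)%nat /\ Rabs (INR j * b - (x + IZR P)) <= b.
Proof.
  (* A large integer [P] pushes the target beyond [N * b], so the multiple of [b] next to it has
     index at least [N]. *)
  intros Hb. destruct (archimed (Rabs x + INR N * b)) as [HP _].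
  set (P := up (Rabs x + INR N * b)) in *.
  assert (Hx : INR N * b <= x + IZR P) by (pose proof (Rle_abs (- x)); rewrite Rabs_Ropp in H; lra).
  destruct (archimed ((x + IZR P) / b)) as [H1 H2].
  set (z := up ((x + IZR P) / b)) in *.
  assert (H3 : x + IZR P < IZR z * b).
  { replace (x + IZR P) with ((x + IZR P) / b * b) by (field; lra). nra. }
  assert (H4 : IZR z * b <= x + IZR P + b).
  { replace (x + IZR P) with ((x + IZR P) / b * b) by (field; lra). nra. }
  assert (Hz : (Z.of_nat N <= z)%Z).
  { apply le_IZR. rewrite <- INR_IZR_INZ. nra. }
  exists (Z.to_nat z), P. split; [lia|].
  rewrite INR_IZR_INZ, Z2Nat.id by lia. apply Rabs_le. lra.
Qed.

(** Irrationality makes the small number [b] nonzero, and its multiples advance in steps shorter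
    than [eps]. The sign of [b] is not controlled, hence the two cases. *)
Lemma kronecker (a : R) : (forall p q : Z, a * IZR q = IZR p -> q = 0%Z) ->
  forall (x eps : R) (N : nat), 0 < eps ->
  exists (n : nat) (p : Z), (N <= n)%nat /\ Rabs (INR n * a - IZR p - x) < eps.
Proof.
  intros Ha x eps N He. destruct (dirichlet_small a eps He) as [q [p [Hq H]]].
  set (b := INR q * a - IZR p) in *.
  assert (Hb : b <> 0).
  { intros E. assert (E' : a * IZR (Z.of_nat q) = IZR p) by (rewrite <- INR_IZR_INZ; unfold b in E; lra).
    apply Ha in E'. lia. }
  assert (Hfin : forall j P, (N <= j)%nat -> Rabs (INR j * b - (x + IZR P)) < eps ->
     exists (n : nat) (p : Z), (N <= n)%nat /\ Rabs (INR n * a - IZR p - x) < eps).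
  { intros j P Hj E. exists (j * q)%nat, (Z.of_nat j * p + P)%Z. split; [nia|].
    rewrite mult_INR, plus_IZR, mult_IZR, <- INR_IZR_INZ.
    replace (INR j * INR q * a - (INR j * IZR p + IZR P) - x) with (INR j * b - (x + IZR P))
      by (unfold b; ring). exact E. }
  destruct (Rtotal_order b 0) as [Hneg|[E|Hpos]]; [|contradiction|].
  - destruct (multiples_dense (- b) (- x) N) as [j [P [Hj E]]]; [lra|].
    apply (Hfin j (- P)%Z Hj). rewrite opp_IZR.
    replace (INR j * b - (x + - IZR P)) with (- (INR j * - b - (- x + IZR P))) by ring.
    rewrite Rabs_Ropp. eapply Rle_lt_trans; [exact E|].
    rewrite Rabs_left in H by exact Hneg. exact H.
  - destruct (multiples_dense b x N) as [j [P [Hj E]]]; [lra|].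
    apply (Hfin j P Hj). eapply Rle_lt_trans; [exact E|].
    rewrite Rabs_pos_eq in H; lra.
Qed.

(** Squaring at most doubles distances on the unit circle, so closeness at level [K] controls all
    lower levels. *)
Lemma solenoid_close (x y : nat -> C) K d : solenoid x -> solenoid y ->
  Cmod (x K - y K) < d -> forall j k, (k + j = K)%nat -> Cmod (x k - y k) < d * 2 ^ j.
Proof.
  intros [Ux Hx] [Uy Hy] H. induction j as [|j IH]; intros k Hk.
  - rewrite Nat.add_0_r in Hk. subst k. simpl. lra.
  - assert (IH' : Cmod (x (S k) - y (S k)) < d * 2 ^ j) by (apply IH; lia).
    rewrite (Hx k), (Hy k).
    replace (x (S k) * x (S k) - y (S k) * y (S k))%C
      with ((x (S k) - y (S k)) * (x (S k) + y (S k)))%C by ring.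
    rewrite Cmod_mult. pose proof (Cmod_triangle (x (S k)) (y (S k))) as T.
    rewrite Ux, Uy in T. pose proof (Cmod_ge_0 (x (S k) - y (S k))).
    pose proof (Cmod_ge_0 (x (S k) + y (S k))). simpl. nra.
Qed.

(** Finitely many coordinates matter, and the highest of them controls the others. There the
    time-one map is the rotation by [2 * PI * (sqrt 2 / 2 ^ K)], an irrational one. *)
Lemma solenoid_dense (x z : nat -> C) (eps : R) (N : nat) :
  solenoid x -> solenoid z -> 0 < eps ->
  exists n, (N <= n)%nat /\ wdist nat_weight (flow x (INR n)) z < eps.
Proof.
  intros Sx Sz He. destruct (wdist_small nat_weight eps He) as [l [d [Hd Hl]]].
  set (K := list_max l).
  assert (HK : forall k, In k l -> (k <= K)%nat).
  { intros k Hk. pose proof (proj1 (list_max_le l K) (le_n _)) as F.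
    rewrite Forall_forall in F. now apply F. }
  pose proof (pow2_pos K) as HpK. pose proof PI_RGT_0 as Hpi.
  destruct (cis_surj (z K * Cconj (x K))) as [a Ha].
  { apply unit_mul; [apply Sz|apply unit_Cconj, Sx]. }
  (* The factor pays for the doublings from level [K] down to level [0]. *)
  set (d' := d / 2 ^ K). assert (Hd' : 0 < d') by (apply Rdiv_lt_0_compat; lra).
  destruct (kronecker (sqrt 2 / 2 ^ K)) with (x := a / (2 * PI)) (eps := d' / (2 * PI)) (N := N)
    as [n [p [Hn H]]].
  - intros p q E. apply (sqrt2_irrational (p * 2 ^ Z.of_nat K) q).
    rewrite mult_IZR, <- pow_IZR, <- E. field. lra.
  - apply Rdiv_lt_0_compat; lra.
  - exists n. split; [exact Hn|]. apply Hl. intros k Hk. specialize (HK k Hk).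
    assert (C : Cmod (flow x (INR n) K - z K) < d').
    { unfold flow.
      assert (Ez : z K = (x K * cis a)%C).
      { rewrite <- Ha. replace (x K * (z K * Cconj (x K)))%C with (z K * (x K * Cconj (x K)))%C by ring.
        rewrite unit_conj by apply Sx. ring. }
      rewrite Ez.
      assert (Ec : cis (tau * INR n / 2 ^ K) = cis (2 * PI * (INR n * (sqrt 2 / 2 ^ K) - IZR p))).
      { replace (tau * INR n / 2 ^ K)
          with (2 * PI * (INR n * (sqrt 2 / 2 ^ K) - IZR p) + 2 * PI * IZR p)
          by (unfold tau; field; lra).
        rewrite cis_plus, cis_2PI. ring. }
      rewrite Ec.
      replace (x K * cis (2 * PI * (INR n * (sqrt 2 / 2 ^ K) - IZR p)) - x K * cis a)%C
        with (x K * (cis (2 * PI * (INR n * (sqrt 2 / 2 ^ K) - IZR p)) - cis a))%C by ring.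
      rewrite Cmod_mult, (proj1 Sx), Rmult_1_l.
      eapply Rle_lt_trans; [apply cis_lip|].
      replace (2 * PI * (INR n * (sqrt 2 / 2 ^ K) - IZR p) - a)
        with (2 * PI * (INR n * (sqrt 2 / 2 ^ K) - IZR p - a / (2 * PI))) by (field; lra).
      rewrite Rabs_mult, (Rabs_pos_eq (2 * PI)) by lra.
      apply (Rmult_lt_reg_r (/ (2 * PI))); [apply Rinv_0_lt_compat; lra|].
      replace (2 * PI * Rabs (INR n * (sqrt 2 / 2 ^ K) - IZR p - a / (2 * PI)) * / (2 * PI))
        with (Rabs (INR n * (sqrt 2 / 2 ^ K) - IZR p - a / (2 * PI))) by (field; lra).
      exact H. }
    pose proof (solenoid_close _ _ K d' (solenoid_flow x (INR n) Sx) Sz C (K - k)%nat k) as F.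
    eapply Rlt_le_trans; [apply F; lia|]. unfold d'.
    apply (Rmult_le_reg_r (2 ^ K)); [exact HpK|].
    replace (d / 2 ^ K * 2 ^ (K - k) * 2 ^ K) with (d * 2 ^ (K - k)) by (field; lra).
    apply Rmult_le_compat_l; [lra|]. apply Rle_pow; [lra|lia].
Qed.

(** An arc of the leaf is compact, hence closed: the parameters of approximating points cluster in
    [[a, b]]. The bound on the parameters is essential, the whole leaf being dense. *)
Lemma iota_compact (x : nat -> C) (a b : R) :
  (forall eps, 0 < eps -> exists s, a <= s <= b /\ wdist nat_weight x (iota s) < eps) ->
  exists s, a <= s <= b /\ x = iota s.
Proof.
  intros H.
  assert (H' : forall n : nat, exists s, a <= s <= b /\ wdist nat_weight x (iota s) < / INR (S n)).
  { intros n. apply H, inv_INR_pos. }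
  set (u := fun n => proj1_sig (constructive_indefinite_description _ (H' n))).
  assert (Hu : forall n, a <= u n <= b /\ wdist nat_weight x (iota (u n)) < / INR (S n)).
  { intros n. unfold u. now destruct (constructive_indefinite_description _ (H' n)). }
  destruct (Bolzano_Weierstrass u (fun s => a <= s <= b) (compact_P3 a b)) as [s Hs].
  { intros n. apply Hu. }
  assert (Hclose : forall eps, 0 < eps -> forall N, exists n, (N <= n)%nat /\ Rabs (u n - s) < eps).
  { intros eps He N. destruct (Hs (disc s (mkposreal eps He)) N) as [n [Hn Hd]].
    - exists (mkposreal eps He). intros y Hy. exact Hy.
    - exists n. split; [exact Hn|exact Hd]. }
  exists s. split.
  - split; apply Rnot_lt_le; intros Hlt.
    + destruct (Hclose (a - s) ltac:(lra) 0%nat) as [n [_ Hn]]. destruct (Hu n) as [Hn' _].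
      apply Rabs_def2 in Hn. lra.
    + destruct (Hclose (s - b) ltac:(lra) 0%nat) as [n [_ Hn]]. destruct (Hu n) as [Hn' _].
      apply Rabs_def2 in Hn. lra.
  - apply (wdist_eq0 nat_weight). apply Rle_antisym; [|apply wdist_ge0].
    apply le_epsilon. intros eps He. rewrite Rplus_0_l. left.
    assert (Hc : @cont_at R_metric R_metric (fun r => wdist nat_weight (iota r) (iota s)) s).
    { apply (cont_at_wdist R_metric nat_weight iota). intros k.
      apply (cont_at_flow R_metric (fun _ => sone) (fun r => r)).
      - intros _. apply solenoid_one.
      - apply (cont_at_const R_metric C_metric).
      - intros e Hee. exists e. now split. }
    destruct (Hc (eps / 2)) as [d [Hd Hcd]]; [lra|].
    destruct (archi_small (eps / 2)) as [N HN]; [lra|].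
    destruct (Hclose d Hd N) as [n [Hn Hns]]. destruct (Hu n) as [_ Hn'].
    specialize (HN n Hn). rewrite Rabs_minus_sym in Hns. specialize (Hcd (u n) Hns). simpl in Hcd.
    rewrite wdist_refl in Hcd. apply Rabs_def2 in Hcd.
    pose proof (wdist_tri nat_weight x (iota (u n)) (iota s)). lra.
Qed.

(** * The space Y *)

(** The weight of [inr n] tends to [0] with [|n|]: this makes the circles over [iota n] shrink. *)
Definition coord_weight : weight (nat + Z).
Proof.
  refine (Build_weight (nat + Z)
            (fun i => match i with inl k => / 2 ^ k | inr n => / 2 ^ Z.abs_nat n end) _ _ _).
  - intros [k|n]; apply (wt_pos nat_weight).
  - intros [k|n]; apply (wt_le1 nat_weight).
  - intros eps He. destruct (wt_fin nat_weight eps He) as [l Hl].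
    exists (map inl l ++ map inr (map Z.of_nat l ++ map (fun k => (- Z.of_nat k)%Z) l)).
    intros [k|n].
    + destruct (Hl k) as [H|H]; [left|now right]. apply in_or_app. left. now apply in_map.
    + destruct (Hl (Z.abs_nat n)) as [H|H]; [left|now right]. apply in_or_app. right.
      apply in_map. apply in_or_app. destruct (Z_le_dec 0 n) as [Hn|Hn].
      * left. apply in_map_iff. exists (Z.abs_nat n). split; [lia|exact H].
      * right. apply in_map_iff. exists (Z.abs_nat n). split; [lia|exact H].
Defined.

Definition base (u : nat + Z -> C) (k : nat) : C := u (inl k).

Definition Yspec (u : nat + Z -> C) : Prop :=
  solenoid (base u) /\ (forall n, Cmod (u (inr n)) = 1) /\
  forall n, base u <> iota (IZR n) -> u (inr n) = cis (/ rho (flow (base u) (- IZR n))).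

(* Over [iota n] the [n]-th oscillating coordinate is free, so the fibre is a circle
   to which the two adjacent pieces of the leaf spiral. *)
Definition Y : MetricSpace := fun_metric coord_weight Yspec.

Definition pr (y : Y) : nat -> C := base (proj1_sig y).
Definition osc (y : Y) (n : Z) : C := proj1_sig y (inr n).

Lemma pr_solenoid (y : Y) : solenoid (pr y).
Proof. apply (proj2_sig y). Qed.

Lemma osc_unit (y : Y) n : Cmod (osc y n) = 1.
Proof. apply (proj2_sig y). Qed.

Lemma osc_eq (y : Y) n : pr y <> iota (IZR n) -> osc y n = cis (/ rho (flow (pr y) (- IZR n))).
Proof. apply (proj2_sig y). Qed.

Lemma Y_ext (y y' : Y) : pr y = pr y' -> (forall n, osc y n = osc y' n) -> y = y'.
Proof.
  destruct y as [u Hu], y' as [u' Hu']. unfold pr, osc. simpl. intros H1 H2.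
  assert (E : u = u').
  { apply functional_extensionality. intros [k|n]; [|apply H2]. exact (equal_f H1 k). }
  subst u'. f_equal. apply proof_irrelevance.
Qed.

Lemma pr_dist (y y' : Y) : wdist nat_weight (pr y) (pr y') <= dist y y'.
Proof.
  apply wdist_le; [apply dist_nonneg|]. intros k.
  exact (wdist_term coord_weight (proj1_sig y) (proj1_sig y') (inl k)).
Qed.

(** Two points over [iota n] differ at most in the free coordinate [inr n], so its weight bounds
    their distance. *)
Lemma fibre_dist (y y' : Y) n : pr y = iota (IZR n) -> pr y' = iota (IZR n) ->
  dist y y' <= / 2 ^ Z.abs_nat n.
Proof.
  intros H H'. apply wdist_le; [left; apply (wt_pos nat_weight)|].
  intros i. assert (Hi : i = inr n \/ proj1_sig y i = proj1_sig y' i).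
  { destruct i as [k|m].
    - right. exact (equal_f (eq_trans H (eq_sym H')) k).
    - destruct (Z.eq_dec m n) as [->|Hm]; [now left|right].
      assert (Hne : iota (IZR n) <> iota (IZR m)) by (intros E; apply iota_inj, eq_IZR in E; congruence).
      change (osc y m = osc y' m). rewrite !osc_eq; rewrite ?H, ?H'; auto. }
  destruct Hi as [->|E].
  - apply (wterm_bounds coord_weight (proj1_sig y) (proj1_sig y') (inr n)).
  - unfold wterm. rewrite E.
    replace (proj1_sig y' i - proj1_sig y' i)%C with (RtoC 0) by ring.
    rewrite Cmod_0, Rmin_right by lra. rewrite Rmult_0_r. left; apply (wt_pos nat_weight).
Qed.

Lemma rho_flow_eq0 x s : rho (flow x (- s)) = 0 <-> x = iota s.
Proof.
  split.
  - intros H. apply rho_eq0 in H. apply (flow_cancel _ _ (- s)). rewrite H, flow_iota.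
    rewrite Rplus_opp_r. symmetry. apply iota_0.
  - intros ->. rewrite flow_iota, Rplus_opp_r, iota_0. apply rho_one.
Qed.

Lemma rho_flow_pos x s : x <> iota s -> 0 < rho (flow x (- s)).
Proof.
  intros H. destruct (rho_ge0 (flow x (- s))) as [H'|H']; [exact H'|].
  exfalso. apply H. now apply rho_flow_eq0.
Qed.

(** * Points and symmetries of [Y] *)

(** The value [c] enters only when [x] is some [iota n], and then for that single [n], [iota] being
    injective. *)
Definition fibre_point (x : nat -> C) (c : C) (i : nat + Z) : C :=
  match i with
  | inl k => x k
  | inr n => if excluded_middle_informative (x = iota (IZR n)) then c
             else cis (/ rho (flow x (- IZR n)))
  end.

Lemma fibre_point_spec x c : solenoid x -> Cmod c = 1 -> Yspec (fibre_point x c).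
Proof.
  intros Hx Hc. split; [exact Hx|]. split.
  - intros n. simpl. destruct excluded_middle_informative; [exact Hc|apply Cmod_cis].
  - intros n Hn. simpl. destruct excluded_middle_informative as [E|E]; [contradiction|reflexivity].
Qed.

(** Over a circle the choice of [1] is arbitrary; over any other point this is the whole fibre (see
    [pt_eq]). *)
Definition pt (x : nat -> C) (Hx : solenoid x) : Y :=
  exist _ (fibre_point x (RtoC 1)) (fibre_point_spec x (RtoC 1) Hx Cmod_1).

Lemma shift_spec (k : Z) (u : nat + Z -> C) : Yspec u ->
  Yspec (fun i => match i with inl j => flow (base u) (IZR k) j | inr n => u (inr (n - k)%Z) end).
Proof.
  intros [H1 [H2 H3]]. split; [exact (solenoid_flow _ _ H1)|]. split; [intros; apply H2|].
  intros n Hn. match type of Hn with base ?v <> _ => change (base v) with (flow (base u) (IZR k)) in * end.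
  cbv beta iota. rewrite H3.
  - rewrite flow_add, minus_IZR. do 4 f_equal. ring.
  - intros E. apply Hn. rewrite E, flow_iota, minus_IZR. f_equal. ring.
Qed.

Definition shift (k : Z) (y : Y) : Y := exist _ _ (shift_spec k _ (proj2_sig y)).

(** Inversion lifts because [rho] is invariant under it, so that the oscillation about [iota n] is
    carried to the one about [iota (- n)]. *)
Lemma refl_spec (u : nat + Z -> C) : Yspec u ->
  Yspec (fun i => match i with inl j => sconj (base u) j | inr n => u (inr (- n)%Z) end).
Proof.
  intros [H1 [H2 H3]]. split; [exact (solenoid_conj _ H1)|]. split; [intros; apply H2|].
  intros n Hn. match type of Hn with base ?v <> _ => change (base v) with (sconj (base u)) in * end.
  cbv beta iota. rewrite H3.
  - rewrite opp_IZR, <- (rho_conj (flow (base u) _)), sconj_flow. do 4 f_equal. ring.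
  - intros E. apply Hn. rewrite E, sconj_iota, opp_IZR. f_equal. ring.
Qed.

Definition reflect (y : Y) : Y := exist _ _ (refl_spec _ (proj2_sig y)).

Lemma pr_shift k y : pr (shift k y) = flow (pr y) (IZR k).
Proof. reflexivity. Qed.

Lemma pr_reflect y : pr (reflect y) = sconj (pr y).
Proof. reflexivity. Qed.

Lemma pr_pt x Hx : pr (pt x Hx) = x.
Proof. reflexivity. Qed.

Lemma shift_add a b y : shift a (shift b y) = shift (a + b) y.
Proof.
  apply Y_ext.
  - rewrite !pr_shift, flow_add, plus_IZR. f_equal. ring.
  - intros n. unfold osc, shift. simpl. do 2 f_equal. ring.
Qed.

Lemma shift_0 y : shift 0 y = y.
Proof.
  apply Y_ext.
  - rewrite pr_shift. apply flow_0.
  - intros n. unfold osc, shift. simpl. do 2 f_equal. ring.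
Qed.

Lemma reflect_reflect y : reflect (reflect y) = y.
Proof.
  apply Y_ext.
  - rewrite !pr_reflect. apply sconj_sconj.
  - intros n. unfold osc, reflect. simpl. do 2 f_equal. ring.
Qed.

Lemma reflect_shift k y : reflect (shift k y) = shift (- k) (reflect y).
Proof.
  apply Y_ext.
  - rewrite pr_reflect, !pr_shift, pr_reflect, sconj_flow, opp_IZR. reflexivity.
  - intros n. unfold osc, reflect, shift. simpl. do 2 f_equal. ring.
Qed.

Lemma cont_at_pr (y : Y) k : @cont_at Y C_metric (fun z => pr z k) y.
Proof. apply (cont_at_coord coord_weight Yspec (inl k)). Qed.

Lemma cont_at_osc_proj (y : Y) n : @cont_at Y C_metric (fun z => osc z n) y.
Proof. apply (cont_at_coord coord_weight Yspec (inr n)). Qed.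

Lemma cont_at_into_Y (M : MetricSpace) (f : M -> Y) x :
  (forall k, @cont_at M C_metric (fun m => pr (f m) k) x) ->
  (forall n, @cont_at M C_metric (fun m => osc (f m) n) x) -> cont_at f x.
Proof.
  intros H1 H2. apply (cont_at_into_fun coord_weight Yspec). intros [k|n]; [apply H1|apply H2].
Qed.

Lemma shift_cont k : mcont Y Y (shift k).
Proof.
  intros y. apply cont_at_into_Y.
  - intros j. apply (cont_at_flow Y pr (fun _ => IZR k)).
    + intros z. apply pr_solenoid.
    + apply cont_at_pr.
    + apply (cont_at_const Y R_metric).
  - intros n. apply (cont_at_osc_proj y (n - k)%Z).
Qed.

Lemma reflect_cont : mcont Y Y reflect.
Proof.
  intros y. apply cont_at_into_Y.
  - intros j. apply (cont_at_Cconj Y (fun z => pr z j)). apply cont_at_pr.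
  - intros n. apply (cont_at_osc_proj y (- n)%Z).
Qed.

(** * Neighbourhoods and continuity in [Y] *)

Definition S_metric : MetricSpace := fun_metric nat_weight solenoid.

(** Away from [iota n] the [n]-th oscillating coordinate is a continuous function of the base point,
    so only the distance of base points is measured. *)
Lemma osc_near (y : Y) n eps : pr y <> iota (IZR n) -> 0 < eps ->
  exists d, 0 < d /\ forall y', wdist nat_weight (pr y) (pr y') < d -> Cmod (osc y n - osc y' n) < eps.
Proof.
  intros Hy He.
  set (F := fun x : S_metric => cis (/ rho (flow (proj1_sig x) (- IZR n)))).
  set (x := exist _ (pr y) (pr_solenoid y) : S_metric).
  assert (HF : @cont_at S_metric C_metric F x).
  { apply (cont_at_cis S_metric (fun x => / rho (flow (proj1_sig x) (- IZR n)))).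
    apply (cont_at_inv S_metric (fun x => rho (flow (proj1_sig x) (- IZR n)))).
    - pose proof (rho_flow_pos _ _ Hy). simpl. lra.
    - apply (cont_at_rho S_metric). intros k.
      apply (cont_at_flow S_metric (fun x => proj1_sig x) (fun _ => - IZR n)).
      + intros z. apply (proj2_sig z).
      + apply (cont_at_coord nat_weight solenoid).
      + apply (cont_at_const S_metric R_metric). }
  destruct (HF eps He) as [d [Hd H]].
  assert (Hpos : 0 < wdist nat_weight (pr y) (iota (IZR n))).
  { destruct (wdist_ge0 nat_weight (pr y) (iota (IZR n))) as [H'|H']; [exact H'|].
    exfalso. apply Hy. now apply (wdist_eq0 nat_weight). }
  (* The second bound keeps [pr y'] off [iota n], where [osc y' n] is not given by the formula. *)
  exists (Rmin d (wdist nat_weight (pr y) (iota (IZR n)))). split; [now apply Rmin_pos|].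
  intros y' Hy'. rewrite !osc_eq.
  - apply (H (exist _ (pr y') (pr_solenoid y'))). eapply Rlt_le_trans; [exact Hy'|apply Rmin_l].
  - intros E. rewrite E in Hy'.
    pose proof (Rmin_r d (wdist nat_weight (pr y) (iota (IZR n)))). lra.
  - exact Hy.
Qed.

(** A neighbourhood of [y] is described by the base point and at most one more coordinate, the free
    one if [y] lies on a circle. *)
Lemma near_fibre (y : Y) eps : 0 < eps ->
  exists d, 0 < d /\ forall y', wdist nat_weight (pr y) (pr y') < d ->
    (forall m, pr y = iota (IZR m) -> Cmod (osc y m - osc y' m) < d) -> dist y y' < eps.
Proof.
  intros He. destruct (wdist_small coord_weight eps He) as [l [e [Hee Hl]]].
  assert (H : exists d, 0 < d /\ forall y', wdist nat_weight (pr y) (pr y') < d ->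
    (forall m, pr y = iota (IZR m) -> Cmod (osc y m - osc y' m) < d) ->
    forall i, In i l -> Cmod (proj1_sig y i - proj1_sig y' i) < e).
  { clear Hl. induction l as [|i l [d [Hd IH]]].
    - exists 1. split; [lra|]. intros y' _ _ i [].
    - assert (Hi : exists d', 0 < d' /\ forall y', wdist nat_weight (pr y) (pr y') < d' ->
         (forall m, pr y = iota (IZR m) -> Cmod (osc y m - osc y' m) < d') ->
         Cmod (proj1_sig y i - proj1_sig y' i) < e).
      { destruct i as [k|n].
        - destruct (wdist_coord nat_weight k e Hee) as [d' [Hd' H']]. exists d'. split; [exact Hd'|].
          intros y' Hy' _. exact (H' _ _ Hy').
        - destruct (classic (pr y = iota (IZR n))) as [E|E].
          + exists e. split; [exact Hee|]. intros y' _ H'. exact (H' n E).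
          + destruct (osc_near y n e E Hee) as [d' [Hd' H']]. exists d'. split; [exact Hd'|].
            intros y' Hy' _. exact (H' _ Hy'). }
      destruct Hi as [d' [Hd' H']]. exists (Rmin d d'). split; [now apply Rmin_pos|].
      intros y' H1 H2 j [<-|Hj].
      + apply H'; [eapply Rlt_le_trans; [exact H1|apply Rmin_r]|].
        intros m Hm. eapply Rlt_le_trans; [exact (H2 m Hm)|apply Rmin_r].
      + apply IH; [eapply Rlt_le_trans; [exact H1|apply Rmin_l]| |exact Hj].
        intros m Hm. eapply Rlt_le_trans; [exact (H2 m Hm)|apply Rmin_l]. }
  destruct H as [d [Hd H]]. exists d. split; [exact Hd|]. intros y' H1 H2.
  apply Hl. now apply H.
Qed.

(** Off the circles every oscillating coordinate follows the base point, so continuity in the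
    solenoid suffices. *)
Lemma cont_at_regular (M : MetricSpace) (f : M -> Y) x :
  (forall k, @cont_at M C_metric (fun m => pr (f m) k) x) ->
  (forall n, pr (f x) <> iota (IZR n)) -> cont_at f x.
Proof.
  intros H1 H2 eps He. destruct (near_fibre (f x) eps He) as [d [Hd H]].
  assert (Hw : @cont_at M R_metric (fun m => wdist nat_weight (pr (f m)) (pr (f x))) x)
    by (apply (cont_at_wdist M nat_weight); exact H1).
  destruct (Hw d Hd) as [r [Hr Hr']]. exists r. split; [exact Hr|].
  intros m Hm. apply H.
  - specialize (Hr' m Hm). simpl in Hr'. rewrite wdist_refl in Hr'. apply Rabs_def2 in Hr'.
    rewrite wdist_sym. lra.
  - intros n Hn. exfalso. exact (H2 n Hn).
Qed.

Lemma flow_cont x s k : solenoid x -> @cont_at R_metric C_metric (fun r => flow x r k) s.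
Proof.
  intros Hx. apply (cont_at_flow R_metric (fun _ => x) (fun r => r)).
  - intros _. apply Hx.
  - apply (cont_at_const R_metric C_metric).
  - intros e He. exists e. now split.
Qed.

Lemma rho_iota_cont : mcont R_metric R_metric (fun s => rho (iota s)).
Proof. intros s. apply (cont_at_rho R_metric iota). intros k. apply flow_cont, solenoid_one. Qed.

(** * Oscillation and density in [Y] *)

Lemma rho_iota_pos s : s <> 0 -> 0 < rho (iota s).
Proof.
  intros H. destruct (rho_ge0 (iota s)) as [H'|H']; [exact H'|]. exfalso. apply H.
  apply iota_inj. rewrite iota_0. now apply rho_eq0.
Qed.

Lemma rho_iota_opp s : rho (iota (- s)) = rho (iota s).
Proof. rewrite <- sconj_iota. apply rho_conj. Qed.

(** As [f] tends to [0], [/ f] sweeps all large reals, so [cis (/ f s)] runs through the whole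
    circle. *)
Lemma oscillation_value (f : R -> R) a b c : mcont R_metric R_metric f -> a < b ->
  (forall s, 0 <= f s) -> f a = 0 -> 0 < f b -> Cmod c = 1 ->
  exists s, a < s <= b /\ 0 < f s /\ cis (/ f s) = c.
Proof.
  intros Cf Hab Hf Ha Hb Hc. destruct (cis_surj c Hc) as [t ->]. pose proof PI_RGT_0.
  (* [N] turns are added to the argument [t] of [c] so that [/ T] falls between [f a = 0] and
     [f b]. *)
  destruct (archimed (Rabs t + / f b)) as [HN _]. set (N := up (Rabs t + / f b)) in *.
  pose proof (Rle_abs (- t)) as Ht. rewrite Rabs_Ropp in Ht.
  pose proof (Rinv_0_lt_compat _ Hb). pose proof (Rabs_pos t). pose proof PI2_1.
  set (T := t + 2 * PI * IZR N).
  assert (HT : / f b < T).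
  { unfold T. assert (1 * IZR N <= 2 * PI * IZR N) by (apply Rmult_le_compat_r; lra). lra. }
  assert (HT0 : 0 < T) by lra.
  destruct (IVT_value f a b (/ T) Cf) as [s [Hs E]]; [lra| |].
  - left. rewrite Ha. split; [left; now apply Rinv_0_lt_compat|].
    rewrite <- (Rinv_inv (f b)). left. apply Rinv_lt_contravar; [nra|exact HT].
  - pose proof (Rinv_0_lt_compat _ HT0). exists s. split; [|split].
    + destruct (Req_dec a s) as [<-|Hne]; [rewrite Ha in E; lra|lra].
    + lra.
    + rewrite E, Rinv_inv. unfold T. rewrite cis_plus, cis_2PI. ring.
Qed.

(** The time [s] is chosen so that the oscillation over [iota (m + e * s)] takes exactly the value
    [osc y m]. Every point of the circle is thus a limit from both sides, [rho] being even along
    [iota]. *)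
Lemma leaf_approximates (y : Y) (m : Z) (e eps r : R) :
  pr y = iota (IZR m) -> (e = 1 \/ e = -1) -> 0 < eps -> 0 < r ->
  exists s, 0 < s < r /\ forall y', pr y' = iota (IZR m + e * s) -> dist y y' < eps.
Proof.
  intros Hy He Heps Hr. destruct (near_fibre y eps Heps) as [d [Hd H]].
  destruct (rho_iota_cont 0 d Hd) as [r' [Hr' Hc]].
  set (q := Rmin (Rmin r r') 1 / 2).
  assert (Hq : 0 < q < r /\ q < r' /\ q < 1).
  { unfold q. assert (0 < Rmin (Rmin r r') 1) by (repeat apply Rmin_pos; lra).
    pose proof (Rmin_l (Rmin r r') 1). pose proof (Rmin_r (Rmin r r') 1).
    pose proof (Rmin_l r r'). pose proof (Rmin_r r r'). lra. }
  destruct (oscillation_value (fun s => rho (iota s)) 0 q (osc y m)) as [s [Hs [Hps Es]]].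
  - apply rho_iota_cont.
  - lra.
  - intros; apply rho_ge0.
  - rewrite iota_0. apply rho_one.
  - apply rho_iota_pos. lra.
  - apply osc_unit.
  - exists s. split; [lra|]. intros y' Hy'.
    assert (Er : rho (iota (e * s)) = rho (iota s)).
    { destruct He as [->| ->]; [now rewrite Rmult_1_l|].
      replace (-1 * s) with (- s) by ring. apply rho_iota_opp. }
    apply H.
    + rewrite Hy, Hy', <- (flow_iota (IZR m) (e * s)).
      replace (iota (IZR m)) with (flow (iota 0) (IZR m)) at 1 by (rewrite flow_iota; f_equal; ring).
      replace (flow (iota (IZR m)) (e * s)) with (flow (iota (e * s)) (IZR m))
        by (rewrite !flow_iota; f_equal; ring).
      rewrite wdist_flow, iota_0, wdist_sym. fold (rho (iota (e * s))). rewrite Er.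
      assert (Hd0 : @dist R_metric 0 s < r').
      { simpl. rewrite Rminus_0_l, Rabs_Ropp, Rabs_pos_eq; lra. }
      specialize (Hc s Hd0). simpl in Hc. rewrite iota_0, rho_one in Hc. apply Rabs_def2 in Hc. lra.
    + intros m' Hm'. rewrite Hy in Hm'. apply iota_inj, eq_IZR in Hm'. subst m'.
      rewrite (osc_eq y').
      * rewrite Hy', flow_iota. replace (IZR m + e * s + - IZR m) with (e * s) by ring.
        rewrite Er, Es. replace (osc y m - osc y m)%C with (RtoC 0) by ring. rewrite Cmod_0. exact Hd.
      * rewrite Hy'. intros E. apply iota_inj in E. destruct He as [->| ->]; lra.
Qed.

(** Density in the solenoid suffices near a point off the circles; a point on a circle is first
    replaced by a nearby one on the adjacent spiral. The claim covers every [y'] over the visited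
    base point, hence whole circles. *)
Lemma Y_fibre_dense (x : nat -> C) (y : Y) eps N : solenoid x -> 0 < eps ->
  exists n, (N <= n)%nat /\ forall y', pr y' = flow x (INR n) -> dist y y' < eps.
Proof.
  intros Hx.
  assert (Hreg : forall (y : Y) eps, (forall m, pr y <> iota (IZR m)) -> 0 < eps ->
     exists n, (N <= n)%nat /\ forall y', pr y' = flow x (INR n) -> dist y y' < eps).
  { clear y eps. intros y eps Hy He. destruct (near_fibre y eps He) as [d [Hd H]].
    destruct (solenoid_dense x (pr y) d N Hx (pr_solenoid y) Hd) as [n [Hn Hn']].
    exists n. split; [exact Hn|]. intros y' Hy'. apply H.
    - rewrite Hy', wdist_sym. exact Hn'.
    - intros m Hm. exfalso. exact (Hy m Hm). }
  intros He. destruct (classic (exists m, pr y = iota (IZR m))) as [[m Hm]|Hm].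
  - destruct (leaf_approximates y m 1 (eps / 2) 1 Hm) as [s [Hs Hs']]; [now left|lra|lra|].
    set (z := pt _ (solenoid_iota (IZR m + 1 * s))).
    assert (Hz : dist y z < eps / 2) by (apply Hs'; reflexivity).
    destruct (Hreg z (eps / 2)) as [n [Hn Hn']]; [|lra|].
    + intros k E. unfold z in E. rewrite pr_pt in E. apply iota_inj in E.
      assert (H1 : (m < k)%Z) by (apply lt_IZR; lra).
      assert (H2 : (k < m + 1)%Z) by (apply lt_IZR; rewrite plus_IZR; lra). lia.
    + exists n. split; [exact Hn|]. intros y' Hy'. specialize (Hn' y' Hy').
      pose proof (dist_tri Y y z y'). lra.
  - apply Hreg; [|exact He]. intros m E. apply Hm. now exists m.
Qed.

(** * Compactness of [Y] *)

Lemma limit_eq (M N : MetricSpace) (A B : M -> N) (u : nat -> M) (x : M) :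
  (forall eps, 0 < eps -> exists n0, forall n, (n0 <= n)%nat -> dist (u n) x < eps) ->
  cont_at A x -> cont_at B x -> (exists n0, forall n, (n0 <= n)%nat -> A (u n) = B (u n)) -> A x = B x.
Proof.
  intros Hu HA HB [n0 Hn0]. apply dist_eq0. apply Rle_antisym; [|apply dist_nonneg].
  apply le_epsilon. intros eps He. rewrite Rplus_0_l. left.
  destruct (HA (eps / 2)) as [d1 [Hd1 H1]]; [lra|]. destruct (HB (eps / 2)) as [d2 [Hd2 H2]]; [lra|].
  destruct (Hu (Rmin d1 d2)) as [n1 Hn1]; [now apply Rmin_pos|].
  set (n := Nat.max n0 n1). assert (Hd : dist x (u n) < Rmin d1 d2) by (rewrite dist_sym; apply Hn1; lia).
  assert (E : A (u n) = B (u n)) by (apply Hn0; lia).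
  specialize (H1 (u n)). specialize (H2 (u n)).
  pose proof (Rmin_l d1 d2). pose proof (Rmin_r d1 d2).
  specialize (H1 ltac:(lra)). specialize (H2 ltac:(lra)).
  pose proof (dist_tri N (A x) (B (u n)) (B x)) as T. rewrite (dist_sym N (B (u n))), <- E in T.
  rewrite <- E in H2. lra.
Qed.

(** All conditions in [Yspec] are equalities of continuous functions; the conditional one has an
    open premise, which holds along a tail of the sequence if it holds at the limit. *)
Lemma Y_compact : compact Y.
Proof.
  apply complete_tb_compact.
  2: { apply fun_metric_tb. intros f [Hf1 [Hf2 _]] [k|n]; [|rewrite Hf2; lra].
       pose proof (proj1 Hf1 k) as E. unfold base in E. rewrite E. lra. }
  apply fun_metric_complete. intros u f Hu Hconv.
  (* The larger space of unit families contains the sequence and its limit, which is not yet known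
     to lie in [Y], so that continuity at the limit makes sense. *)
  set (P := fun v : nat + Z -> C => forall i, Cmod (v i) = 1).
  assert (Hun : forall n, P (u n)).
  { intros n [k|m]; [exact (proj1 (proj1 (Hu n)) k)|apply Hu]. }
  assert (Pf : P f).
  { intros i. apply Rle_antisym; apply le_epsilon; intros eps He;
      destruct (wdist_coord coord_weight i eps He) as [d [Hd H]];
      destruct (Hconv d Hd) as [N HN]; specialize (H _ _ (HN N (le_n N))).
    - replace (f i) with (u N i - (u N i - f i))%C by ring. unfold Cminus at 1.
      eapply Rle_trans; [apply Cmod_triangle|]. rewrite Cmod_opp, (Hun N). lra.
    - rewrite <- (Hun N i). replace (u N i) with (f i + (u N i - f i))%C by ring.
      eapply Rle_trans; [apply Cmod_triangle|]. lra. }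
  set (M := fun_metric coord_weight P).
  set (un := fun n => exist P (u n) (Hun n) : M). set (x := exist P f Pf : M).
  assert (Hlim : forall eps, 0 < eps -> exists n0, forall n, (n0 <= n)%nat -> dist (un n) x < eps)
    by exact Hconv.
  assert (Hco : forall i, @cont_at M C_metric (fun v => proj1_sig v i) x)
    by (intros; apply (cont_at_coord coord_weight P)).
  assert (Hunit : forall i (v : M), Cmod (proj1_sig v i) = 1) by (intros i v; apply (proj2_sig v)).
  split; [split|split].
  - intros k. apply Pf.
  - intros k. apply (limit_eq M C_metric (fun v => proj1_sig v (inl k))
                       (fun v => proj1_sig v (inl (S k)) * proj1_sig v (inl (S k)))%C un x Hlim).
    + apply Hco.
    + apply (cont_at_mul M); auto.
    + exists 0%nat. intros n _. exact (proj2 (proj1 (Hu n)) k).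
  - intros n. apply Pf.
  - intros m Hm.
    set (r := fun v : M => rho (flow (base (proj1_sig v)) (- IZR m))).
    assert (Hr : @cont_at M R_metric r x).
    { apply (cont_at_rho M). intros k. apply (cont_at_flow M (fun v => base (proj1_sig v)) (fun _ => - IZR m)).
      - intros v. apply Hunit.
      - apply Hco.
      - apply (cont_at_const M R_metric). }
    assert (Hpos : 0 < r x) by (apply rho_flow_pos; exact Hm).
    apply (limit_eq M C_metric (fun v => proj1_sig v (inr m)) (fun v => cis (/ r v)) un x Hlim).
    + apply Hco.
    + apply (cont_at_cis M (fun v => / r v)). apply (cont_at_inv M r); [lra|exact Hr].
    + destruct (Hr _ Hpos) as [d [Hd H]]. destruct (Hlim d Hd) as [n0 Hn0]. exists n0. intros n Hn.
      apply (proj2 (proj2 (Hu n))). intros E.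
      assert (Hd' : dist x (un n) < d) by (rewrite dist_sym; now apply Hn0).
      specialize (H _ Hd'). assert (E0 : r (un n) = 0) by (apply rho_flow_eq0; exact E).
      simpl in H. rewrite E0, Rminus_0_r, Rabs_pos_eq in H; lra.
Qed.

(** * Leaf, circles and cells over [iota] *)

Definition on_leaf (y : Y) : Prop := exists s, pr y = iota s.

Definition on_fibre (n : Z) (y : Y) : Prop := pr y = iota (IZR n).

Definition on_cell (n : Z) (y : Y) : Prop := exists s, IZR n <= s <= IZR n + 1 /\ pr y = iota s.

(** Cells are closed, being the preimages under [pr] of compact arcs of the leaf. *)
Lemma cell_closed_map (G : Y -> Y) m y : mcont Y Y G ->
  (forall eps, 0 < eps -> exists z, on_cell m (G z) /\ dist y z < eps) -> on_cell m (G y).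
Proof.
  intros CG H. apply iota_compact. intros eps He. destruct (CG y eps He) as [d [Hd Hd']].
  destruct (H d Hd) as [z [[s [Hs Ez]] Hz]]. exists s. split; [exact Hs|]. rewrite <- Ez.
  eapply Rle_lt_trans; [apply pr_dist|]. now apply Hd'.
Qed.

Lemma mcont_id (M : MetricSpace) : mcont M M (fun x => x).
Proof. intros x e He. exists e. now split. Qed.

Lemma cell_closed m y :
  (forall eps, 0 < eps -> exists z, on_cell m z /\ dist y z < eps) -> on_cell m y.
Proof. apply (cell_closed_map (fun y => y)). apply mcont_id. Qed.

Lemma cell_meet n m y : on_cell n y -> on_cell m y -> (Z.abs (n - m) <= 1)%Z.
Proof.
  intros [s [Hs E]] [r [Hr E']]. rewrite E in E'. apply iota_inj in E'. subst r.
  assert ((n <= m + 1)%Z) by (apply le_IZR; rewrite plus_IZR; lra).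
  assert ((m <= n + 1)%Z) by (apply le_IZR; rewrite plus_IZR; lra). lia.
Qed.

Lemma fibre_in_cell n y : on_fibre n y -> on_cell n y.
Proof. intros H. exists (IZR n). split; [lra|exact H]. Qed.

Lemma fibre_in_cell_pred n y : on_fibre n y -> on_cell (n - 1) y.
Proof. intros H. exists (IZR n). rewrite minus_IZR. split; [lra|exact H]. Qed.

Lemma fibre_of_cells n y : on_cell (n - 1) y -> on_cell n y -> on_fibre n y.
Proof.
  intros [s [Hs E]] [r [Hr E']]. unfold on_fibre. rewrite E in *. apply iota_inj in E'. subst r.
  rewrite minus_IZR in Hs. f_equal. lra.
Qed.

Lemma pt_eq (y : Y) x Hx : (forall n, x <> iota (IZR n)) -> pr y = x -> y = pt x Hx.
Proof.
  intros Hr E. apply Y_ext; [exact E|]. intros n. rewrite !osc_eq.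
  - now rewrite E.
  - apply Hr.
  - rewrite E. apply Hr.
Qed.

Definition iota_pt (s : R) : Y := pt (iota s) (solenoid_iota s).

Lemma cell_proper m : exists z, ~ on_cell m z.
Proof.
  exists (iota_pt (IZR m + 2)). intros [s [Hs E]]. unfold iota_pt in E. rewrite pr_pt in E.
  apply iota_inj in E. lra.
Qed.

(** * Paths in [Y] *)

(** A homeomorphism of the line onto [(0, 1)]: open arcs become paths defined on the whole line, as
    the lifting lemmas require. *)
Definition sigmoid (r : R) : R := / (1 + exp (- r)).

Lemma sigmoid_range r : 0 < sigmoid r < 1.
Proof.
  unfold sigmoid. pose proof (exp_pos (- r)). split; [apply Rinv_0_lt_compat; lra|].
  rewrite <- Rinv_1. apply Rinv_lt_contravar; lra.
Qed.

Lemma sigmoid_surj s : 0 < s < 1 -> exists r, sigmoid r = s.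
Proof.
  intros Hs. exists (- ln (/ s - 1)). unfold sigmoid. rewrite Ropp_involutive, exp_ln.
  - field. lra.
  - assert (1 < / s); [|lra]. rewrite <- Rinv_1. apply Rinv_lt_contravar; lra.
Qed.

Lemma sigmoid_cont : mcont R_metric R_metric sigmoid.
Proof.
  intros r. apply (cont_at_inv R_metric (fun r => 1 + exp (- r))).
  - pose proof (exp_pos (- r)). lra.
  - revert r. apply mcont_continuity. apply (continuity_plus (fun _ => 1)).
    + apply continuity_const. now intros x y.
    + apply (continuity_comp (fun r => - r) exp).
      * apply (continuity_opp (fun r => r)). apply derivable_continuous, derivable_id.
      * apply derivable_continuous, derivable_exp.
Qed.

Lemma sigmoid_small i r : r <= - INR i -> sigmoid r <= / INR (S i).
Proof.
  intros H. unfold sigmoid. apply Rinv_le_contravar; [apply lt_0_INR; lia|].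
  pose proof (exp_ineq1_le (- r)). rewrite S_INR. lra.
Qed.

(** The open arc next to the circle over [iota m], to the right for [e = 1] and to the left for
    [e = -1]; the circle is approached as [r] tends to minus infinity. *)
Definition cell_path (m : Z) (e r : R) : Y := iota_pt (IZR m + e * sigmoid r).

Lemma not_int_iota m e s : (e = 1 \/ e = -1) -> 0 < s < 1 ->
  forall n, iota (IZR m + e * s) <> iota (IZR n).
Proof.
  intros He Hs n E. apply iota_inj in E. destruct He as [->| ->].
  - assert ((m < n)%Z) by (apply lt_IZR; lra).
    assert ((n < m + 1)%Z) by (apply lt_IZR; rewrite plus_IZR; lra). lia.
  - assert ((n < m)%Z) by (apply lt_IZR; lra).
    assert ((m - 1 < n)%Z) by (apply lt_IZR; rewrite minus_IZR; lra). lia.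
Qed.

Lemma cell_path_cont m e : (e = 1 \/ e = -1) -> mcont R_metric Y (cell_path m e).
Proof.
  intros He r. apply cont_at_regular.
  - intros k. apply (cont_at_flow R_metric (fun _ => sone) (fun r => IZR m + e * sigmoid r)).
    + intros _. apply solenoid_one.
    + apply (cont_at_const R_metric C_metric).
    + revert r. apply mcont_continuity. apply (continuity_plus (fun _ => IZR m)).
      * apply continuity_const. now intros x y.
      * apply (continuity_scal sigmoid). apply mcont_continuity, sigmoid_cont.
  - apply not_int_iota; [exact He|apply sigmoid_range].
Qed.

Definition fibre_path (n : Z) (t : R) : Y :=
  exist _ (fibre_point (iota (IZR n)) (cis t))
          (fibre_point_spec _ _ (solenoid_iota (IZR n)) (Cmod_cis t)).

Lemma fibre_path_cont n : mcont R_metric Y (fibre_path n).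
Proof.
  intros t. apply cont_at_into_Y.
  - intros k. apply (cont_at_const R_metric C_metric).
  - intros m. unfold osc, fibre_path. simpl. destruct excluded_middle_informative.
    + apply cis_cont.
    + apply (cont_at_const R_metric C_metric).
Qed.

Lemma fibre_path_surj n y : on_fibre n y -> exists t, y = fibre_path n t.
Proof.
  intros H. destruct (cis_surj _ (osc_unit y n)) as [t Ht]. exists t. apply Y_ext; [exact H|].
  intros m. unfold osc at 2, fibre_path. simpl. destruct excluded_middle_informative as [E|E].
  - apply iota_inj, eq_IZR in E. subst m. exact Ht.
  - rewrite osc_eq, H; [reflexivity|]. rewrite H. exact E.
Qed.

Lemma Y_path (g : R -> Y) : mcont R_metric Y g ->
  exists th, mcont R_metric R_metric th /\ th 0 = 0 /\ forall u, pr (g u) = flow (pr (g 0)) (th u).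
Proof.
  intros Cg. apply (solenoid_path (fun u => pr (g u))).
  - intros u. apply pr_solenoid.
  - intros k u. apply (cont_at_comp R_metric Y C_metric g (fun y => pr y k)); [apply Cg|].
    apply cont_at_pr.
Qed.

(** Immediately after the last moment [c] on the circle, the [n]-th oscillating coordinate takes
    every unit value, against continuity at [c]. *)
Lemma path_stuck_right (g : R -> Y) (S : R -> R) n u1 u2 :
  mcont R_metric Y g -> mcont R_metric R_metric S -> (forall u, pr (g u) = iota (S u)) ->
  u1 < u2 -> S u1 = IZR n -> S u2 = IZR n.
Proof.
  intros Cg CS Hg Hu H1. apply NNPP. intros H2.
  assert (CS' : mcont R_metric R_metric (fun u => S u - IZR n)).
  { apply mcont_continuity. apply (continuity_minus S (fun _ => IZR n)).
    - now apply mcont_continuity.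
    - apply continuity_const. now intros x y. }
  destruct (last_zero (fun u => S u - IZR n) u1 u2 CS' Hu) as [c [Hc [Ec Hc']]]; [lra|lra|].
  assert (Co : @cont_at R_metric C_metric (fun u => osc (g u) n) c).
  { apply (cont_at_comp R_metric Y C_metric g (fun y => osc y n)); [apply Cg|].
    apply cont_at_osc_proj. }
  destruct (Co 1) as [d [Hd H]]; [lra|].
  set (b := Rmin u2 (c + d / 2)).
  assert (Hb : c < b <= u2 /\ b < c + d).
  { unfold b. pose proof (Rmin_l u2 (c + d / 2)). pose proof (Rmin_r u2 (c + d / 2)).
    split; [split; [apply Rmin_glb_lt; lra|lra]|lra]. }
  assert (Hv : forall z, Cmod z = 1 -> Cmod (osc (g c) n - z) < 1).
  { intros z Hz.
    destruct (oscillation_value (fun u => rho (iota (S u - IZR n))) c b z) as [s [Hs [Hps Es]]].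
    - intros u. apply (cont_at_comp R_metric R_metric R_metric (fun u => S u - IZR n) (fun s => rho (iota s))).
      + apply CS'.
      + apply rho_iota_cont.
    - lra.
    - intros; apply rho_ge0.
    - rewrite Ec, iota_0. apply rho_one.
    - apply rho_iota_pos. apply Hc'. lra.
    - exact Hz.
    - assert (E : osc (g s) n = z).
      { rewrite osc_eq, Hg, flow_iota.
        - exact Es.
        - rewrite Hg. intros E. apply iota_inj in E. apply (Hc' s); lra. }
      rewrite <- E. apply (H s). simpl. rewrite Rabs_minus_sym, Rabs_pos_eq; lra. }
  (* [1] and [-1] are at distance [2], yet both within less than [1] of [osc (g c) n]. *)
  pose proof (Hv (RtoC 1) Cmod_1) as A. pose proof (Hv (RtoC (-1))) as B.
  rewrite Cmod_R, Rabs_left in B by lra. specialize (B ltac:(lra)).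
  assert (T : Cmod (RtoC 2) < 2).
  { replace (RtoC 2) with ((osc (g c) n - RtoC (-1)) + - (osc (g c) n - RtoC 1))%C
      by (apply C_ext; simpl; ring).
    eapply Rle_lt_trans; [apply Cmod_triangle|]. rewrite Cmod_opp. lra. }
  rewrite Cmod_R, Rabs_pos_eq in T; lra.
Qed.

Lemma path_stuck (g : R -> Y) (S : R -> R) n u1 u2 :
  mcont R_metric Y g -> mcont R_metric R_metric S -> (forall u, pr (g u) = iota (S u)) ->
  S u1 = IZR n -> S u2 = IZR n.
Proof.
  intros Cg CS Hg H1. destruct (Rtotal_order u1 u2) as [H|[->|H]]; [|exact H1|].
  - now apply (path_stuck_right g S n u1 u2).
  - assert (Co : mcont R_metric R_metric (fun u => - u)).
    { apply mcont_continuity. apply (continuity_opp (fun r => r)).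
      apply derivable_continuous, derivable_id. }
    rewrite <- (Ropp_involutive u2).
    apply (path_stuck_right (fun u => g (- u)) (fun u => S (- u)) n (- u1) (- u2)).
    + exact (mcont_comp R_metric R_metric Y _ _ Co Cg).
    + exact (mcont_comp R_metric R_metric R_metric _ _ Co CS).
    + intros u. apply Hg.
    + lra.
    + now rewrite Ropp_involutive.
Qed.

(** Either the path meets a circle and never leaves it, or its parameter avoids all integers and
    stays between two consecutive ones. *)
Lemma leaf_path_in_cell (g : R -> Y) : mcont R_metric Y g -> on_leaf (g 0) ->
  exists m, forall u, on_cell m (g u).
Proof.
  intros Cg [s0 Hs0]. destruct (Y_path g Cg) as [th [Ct [_ Ht]]].
  set (S := fun u => s0 + th u).
  assert (CS : mcont R_metric R_metric S).
  { apply mcont_continuity. apply (continuity_plus (fun _ => s0)).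
    - apply continuity_const. now intros x y.
    - now apply mcont_continuity. }
  assert (HS : forall u, pr (g u) = iota (S u)) by (intros u; now rewrite Ht, Hs0, flow_iota).
  destruct (classic (exists u n, S u = IZR n)) as [[u [n E]]|Hno].
  - exists n. intros v. exists (IZR n). split; [lra|]. rewrite HS. f_equal.
    now apply (path_stuck g S n u v).
  - destruct (base_Int_part (S 0)) as [B1 B2]. set (m := Int_part (S 0)) in *. exists m.
    assert (Hv : forall n a b, S a <= IZR n <= S b -> False).
    { intros n a b H. destruct (Rle_dec a b) as [Hab|Hab].
      - destruct (IVT_value S a b (IZR n) CS Hab) as [z [_ Ez]]; [lra|].
        apply Hno. now exists z, n.
      - destruct (IVT_value S b a (IZR n) CS) as [z [_ Ez]]; [lra|lra|].
        apply Hno. now exists z, n. }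
    intros u. exists (S u). split; [|apply HS]. split; apply Rnot_lt_le; intros H.
    + apply (Hv m u 0). lra.
    + apply (Hv (m + 1)%Z 0 u). rewrite plus_IZR. lra.
Qed.

(** * Connectedness of [Y] *)

(** The two primitive cube roots of unity in alternation, exchanged by squaring: an element of order
    three of the solenoid. *)
Definition omega_seq (k : nat) : C :=
  if Nat.even k then cis (2 * (PI / 3)) else cis (- (2 * (PI / 3))).

Lemma solenoid_omega : solenoid omega_seq.
Proof.
  assert (E : forall a, 3 * a = 2 * PI \/ 3 * a = - (2 * PI) -> cis (- a) = (cis a * cis a)%C).
  { intros a Ha. rewrite <- cis_plus. replace (a + a) with (- a + 3 * a) by ring.
    rewrite cis_plus.
    assert (H : cis (3 * a) = RtoC 1).
    { destruct Ha as [->| ->].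
      - rewrite <- (cis_2PI 1). f_equal. ring.
      - rewrite <- (cis_2PI (-1)). f_equal. ring. }
    rewrite H. ring. }
  split.
  - intros k. unfold omega_seq. destruct Nat.even; apply Cmod_cis.
  - intros k. unfold omega_seq. rewrite Nat.even_succ, <- Nat.negb_even.
    destruct (Nat.even k); simpl negb; cbv iota.
    + rewrite <- E; [f_equal; ring|right; field].
    + apply E. left. field.
Qed.

(** For fixed [s] the coordinates of [iota s] tend to [1], while those of [omega_seq] keep real part
    [-1/2]. *)
Lemma omega_off_leaf s : omega_seq <> iota s.
Proof.
  intros E. destruct (Pow_x_infinity 2) with (b := tau * Rabs s + 1) as [k Hk].
  { rewrite Rabs_pos_eq; lra. }
  specialize (Hk k (le_n k)). pose proof (pow2_pos k) as Hp. rewrite Rabs_pos_eq in Hk by lra.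
  assert (Hre : 0 < fst (omega_seq k)).
  { apply unit_near_1. rewrite E. unfold iota, flow, sone. rewrite Cmult_1_l, <- cis_0.
    eapply Rle_lt_trans; [apply cis_lip|]. rewrite Rminus_0_r.
    unfold Rdiv. rewrite !Rabs_mult, Rabs_inv, (Rabs_pos_eq (2 ^ k)) by lra.
    pose proof tau_pos. rewrite (Rabs_pos_eq tau) by lra.
    apply (Rmult_lt_reg_r (2 ^ k)); [exact Hp|].
    rewrite Rmult_assoc, Rinv_l by lra. lra. }
  unfold omega_seq in Hre. destruct Nat.even; simpl in Hre; rewrite ?cos_neg, cos_2PI3 in Hre; lra.
Qed.

Definition leaf_path (x : nat -> C) (Hx : solenoid x) (r : R) : Y :=
  pt (flow x r) (solenoid_flow x r Hx).

Lemma off_leaf_flow x r : (forall s, x <> iota s) -> forall s, flow x r <> iota s.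
Proof.
  intros H s E. apply (H (s - r)). rewrite <- (flow_0 x), <- (Rplus_opp_r r), <- flow_add, E.
  apply flow_iota.
Qed.

Lemma leaf_path_cont x Hx : (forall s, x <> iota s) -> mcont R_metric Y (leaf_path x Hx).
Proof.
  intros H r. apply cont_at_regular.
  - intros k. apply flow_cont. exact Hx.
  - intros n. apply off_leaf_flow. exact H.
Qed.

Lemma leaf_path_dense x Hx y eps : 0 < eps -> exists r, dist y (leaf_path x Hx r) < eps.
Proof.
  intros He. destruct (Y_fibre_dense x y eps 0 Hx He) as [n [_ Hn]]. exists (INR n).
  apply Hn. reflexivity.
Qed.

(** [Y] is the closure of a path. The leaf of [omega_seq] provides it, since the one of [iota] is
    broken up by the circles. *)
Lemma Y_connected : connected Y.
Proof.
  assert (Main : forall U V : Y -> Prop, is_open Y U -> is_open Y V ->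
    (forall x, U x \/ V x) -> (forall x, ~ (U x /\ V x)) ->
    U (leaf_path _ solenoid_omega 0) -> forall x, U x).
  { intros U V HU HV Hc Hd H0.
    set (g := leaf_path _ solenoid_omega) in *.
    assert (Cg : mcont R_metric Y g) by (apply leaf_path_cont, omega_off_leaf).
    set (f := fun r => if excluded_middle_informative (U (g r)) then 1 else -1).
    assert (Cf : mcont R_metric R_metric f).
    { intros r. destruct (classic (U (g r))) as [HUr|HUr].
      - destruct (HU _ HUr) as [e [He He']]. destruct (Cg r e He) as [d [Hd0 Hd']].
        apply (cont_at_ext_near R_metric R_metric f (fun _ => 1) r d Hd0).
        + intros s Hs. unfold f. destruct excluded_middle_informative as [H|H]; [reflexivity|].
          exfalso. apply H. apply He'. now apply Hd'.
        + apply (cont_at_const R_metric R_metric).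
      - assert (HVr : V (g r)) by (destruct (Hc (g r)); [contradiction|assumption]).
        destruct (HV _ HVr) as [e [He He']]. destruct (Cg r e He) as [d [Hd0 Hd']].
        apply (cont_at_ext_near R_metric R_metric f (fun _ => -1) r d Hd0).
        + intros s Hs. unfold f. destruct excluded_middle_informative as [H|H]; [|reflexivity].
          exfalso. apply (Hd (g s)). split; [exact H|]. apply He'. now apply Hd'.
        + apply (cont_at_const R_metric R_metric). }
    assert (Hall : forall r, U (g r)).
    { intros r. apply NNPP. intros Hn.
      assert (E0 : f 0 = 1) by (unfold f; destruct excluded_middle_informative; [reflexivity|contradiction]).
      assert (Er : f r = -1) by (unfold f; destruct excluded_middle_informative; [contradiction|reflexivity]).
      assert (Hz : exists z, f z = 0).
      { destruct (Rle_dec 0 r) as [Hr|Hr].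
        - destruct (IVT_value f 0 r 0 Cf Hr) as [z [_ Hz]]; [lra|]. now exists z.
        - destruct (IVT_value f r 0 0 Cf) as [z [_ Hz]]; [lra|lra|]. now exists z. }
      destruct Hz as [z Hz]. unfold f in Hz. destruct excluded_middle_informative; lra. }
    intros y. apply NNPP. intros Hy.
    assert (HVy : V y) by (destruct (Hc y); [contradiction|assumption]).
    destruct (HV y HVy) as [e [He He']].
    destruct (leaf_path_dense _ solenoid_omega y e He) as [r Hr].
    apply (Hd (g r)). split; [apply Hall|]. now apply He'. }
  intros U V HU HV Hc Hd. destruct (Hc (leaf_path _ solenoid_omega 0)) as [H|H].
  - left. now apply (Main U V).
  - right. apply (Main V U); auto. intros x. destruct (Hc x); auto. intros x [A B]. now apply (Hd x).
Qed.

(** * Continuous surjections of Y *)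

Definition surjective (G : Y -> Y) : Prop := forall y, exists z, G z = y.

(** Otherwise the leaf of [y] is a dense path whose image meets the leaf of [iota] and hence stays
    in one cell. That cell is closed, so it contains the whole image of [G], against
    surjectivity. *)
Lemma off_leaf_map (G : Y -> Y) y : mcont Y Y G -> surjective G -> on_leaf (G y) -> on_leaf y.
Proof.
  intros CG SG HG. apply NNPP. intros Hy.
  assert (Hoff : forall s, pr y <> iota s) by (intros s E; apply Hy; now exists s).
  set (p := leaf_path (pr y) (pr_solenoid y)).
  assert (E0 : p 0 = y).
  { symmetry. apply pt_eq; [intros n; now apply off_leaf_flow|]. symmetry. apply flow_0. }
  destruct (leaf_path_in_cell (fun r => G (p r))) as [m Hm].
  - exact (mcont_comp R_metric Y Y _ _ (leaf_path_cont _ _ Hoff) CG).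
  - now rewrite E0.
  - destruct (cell_proper m) as [z Hz]. apply Hz. destruct (SG z) as [z' <-].
    apply cell_closed_map; [exact CG|]. intros eps He.
    destruct (leaf_path_dense _ (pr_solenoid y) z' eps He) as [r Hr].
    exists (p r). split; [apply Hm|exact Hr].
Qed.

(** A cell is the closure of its open arc: by the oscillation the arc accumulates on the whole
    circle at either end. *)
Lemma cell_closure m y eps : on_cell m y -> 0 < eps ->
  exists s, 0 < s < 1 /\ dist y (iota_pt (IZR m + s)) < eps.
Proof.
  intros [s [Hs E]] He.
  destruct (Req_dec s (IZR m)) as [Hm|Hm]; [|destruct (Req_dec s (IZR m + 1)) as [Hm'|Hm']].
  - subst s. destruct (leaf_approximates y m 1 eps 1 E) as [s [Hs' H]]; [now left|exact He|lra|].
    exists s. split; [exact Hs'|]. apply H. unfold iota_pt. rewrite pr_pt. f_equal. ring.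
  - subst s. rewrite <- plus_IZR in E.
    destruct (leaf_approximates y (m + 1) (-1) eps 1 E) as [s [Hs' H]]; [now right|exact He|lra|].
    exists (1 - s). split; [lra|]. apply H. unfold iota_pt. rewrite pr_pt, plus_IZR. f_equal. ring.
  - exists (s - IZR m). split; [lra|].
    replace (IZR m + (s - IZR m)) with s by ring.
    replace (iota_pt s) with y; [now rewrite dist_refl|].
    apply pt_eq; [|exact E].
    replace s with (IZR m + 1 * (s - IZR m)) by ring.
    apply not_int_iota; [now left|lra].
Qed.

(** One point of the open arc with image on the leaf suffices: the image of the arc is a path,
    trapped in one cell, and the arc is dense in its cell. *)
Lemma cell_of_path (G : Y -> Y) n r : mcont Y Y G -> on_leaf (G (cell_path n 1 r)) ->
  exists p, forall y, on_cell n y -> on_cell p (G y).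
Proof.
  intros CG H.
  (* The parameter is shifted to place the given point at time [0], where [leaf_path_in_cell]
     expects it. *)
  assert (Ct : mcont R_metric R_metric (fun u => u + r)).
  { apply mcont_continuity. apply (continuity_plus (fun u => u) (fun _ => r)).
    - apply derivable_continuous, derivable_id.
    - apply continuity_const. now intros x y. }
  destruct (leaf_path_in_cell (fun u => G (cell_path n 1 (u + r)))) as [p Hp].
  - apply (mcont_comp R_metric Y Y (fun u => cell_path n 1 (u + r)) G); [|exact CG].
    apply (mcont_comp R_metric R_metric Y (fun u => u + r) (cell_path n 1)); [exact Ct|].
    apply cell_path_cont. now left.
  - now rewrite Rplus_0_l.
  - exists p. intros y Hy. apply cell_closed_map; [exact CG|]. intros eps He.
    destruct (cell_closure n y eps Hy He) as [s [Hs Hd]].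
    destruct (sigmoid_surj s Hs) as [u Hu].
    exists (cell_path n 1 u). split.
    + specialize (Hp (u - r)). now replace (u - r + r) with u in Hp by ring.
    + unfold cell_path. rewrite Hu, Rmult_1_l. exact Hd.
Qed.

Lemma fibre_to_cell (G : Y -> Y) m y : mcont Y Y G -> on_fibre m y -> on_leaf (G y) ->
  exists p, forall z, on_fibre m z -> on_cell p (G z).
Proof.
  intros CG Hy HG. destruct (fibre_path_surj m y Hy) as [t Ht].
  assert (Ct : mcont R_metric R_metric (fun u => u + t)).
  { apply mcont_continuity. apply (continuity_plus (fun u => u) (fun _ => t)).
    - apply derivable_continuous, derivable_id.
    - apply continuity_const. now intros a b. }
  destruct (leaf_path_in_cell (fun u => G (fibre_path m (u + t)))) as [p Hp].
  - apply (mcont_comp R_metric Y Y (fun u => fibre_path m (u + t)) G); [|exact CG].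
    apply (mcont_comp R_metric R_metric Y (fun u => u + t) (fibre_path m)); [exact Ct|].
    apply fibre_path_cont.
  - rewrite Rplus_0_l, <- Ht. exact HG.
  - exists p. intros z Hz. destruct (fibre_path_surj m z Hz) as [u ->].
    specialize (Hp (u - t)). now replace (u - t + t) with u in Hp by ring.
Qed.

(** As [r] tends to minus infinity the spiral clusters only on the circle over [iota m], whose image
    lies over the arc; images staying away from the arc would contradict this at a cluster point. *)
Lemma wdist_near_cell_path (G : Y -> Y) m e p eps : mcont Y Y G -> (e = 1 \/ e = -1) ->
  (forall z, on_fibre m z -> on_cell p (G z)) -> 0 < eps ->
  exists r0, forall r, r <= r0 -> exists s, IZR p <= s <= IZR p + 1 /\
    wdist nat_weight (pr (G (cell_path m e r))) (iota s) < eps.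
Proof.
  intros CG He Hp Heps. apply NNPP. intros Hno.
  assert (Hr : forall i : nat, exists r, r <= - INR i /\ forall s, IZR p <= s <= IZR p + 1 ->
            ~ wdist nat_weight (pr (G (cell_path m e r))) (iota s) < eps).
  { intros i. apply NNPP. intros H. apply Hno. exists (- INR i). intros r Hr.
    apply NNPP. intros H'. apply H. exists r. split; [exact Hr|]. intros s Hs Hd. apply H'.
    now exists s. }
  set (ri := fun i => proj1_sig (constructive_indefinite_description _ (Hr i))).
  assert (Hri : forall i, ri i <= - INR i /\ forall s, IZR p <= s <= IZR p + 1 ->
            ~ wdist nat_weight (pr (G (cell_path m e (ri i)))) (iota s) < eps).
  { intros i. unfold ri. now destruct (constructive_indefinite_description _ (Hr i)). }
  destruct (compact_cluster Y Y_compact (fun i => cell_path m e (ri i))) as [y Hy].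
  assert (Hfib : on_fibre m y).
  { apply (wdist_eq0 nat_weight). apply Rle_antisym; [|apply wdist_ge0].
    apply le_epsilon. intros eta Heta. rewrite Rplus_0_l.
    assert (Cw : @cont_at R_metric R_metric (fun r => wdist nat_weight (iota r) (iota (IZR m))) (IZR m)).
    { apply (cont_at_wdist R_metric nat_weight iota). intros k. apply flow_cont, solenoid_one. }
    destruct (Cw (eta / 2)) as [d [Hd Hd']]; [lra|].
    destruct (archi_small d Hd) as [N HN].
    destruct (Hy (eta / 2) ltac:(lra) N) as [i [Hi Hi']].
    pose proof (pr_dist (cell_path m e (ri i)) y) as Hpr.
    unfold cell_path at 1, iota_pt in Hpr. rewrite pr_pt in Hpr.
    pose proof (sigmoid_small i (ri i) (proj1 (Hri i))) as Hsm.
    pose proof (sigmoid_range (ri i)) as Hsr. specialize (HN i Hi).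
    assert (Hdd : @dist R_metric (IZR m) (IZR m + e * sigmoid (ri i)) < d).
    { simpl. replace (IZR m - (IZR m + e * sigmoid (ri i))) with (- (e * sigmoid (ri i))) by ring.
      rewrite Rabs_Ropp. destruct He as [->| ->].
      - rewrite Rmult_1_l, Rabs_pos_eq; lra.
      - replace (-1 * sigmoid (ri i)) with (- sigmoid (ri i)) by ring.
        rewrite Rabs_Ropp, Rabs_pos_eq; lra. }
    specialize (Hd' _ Hdd). simpl in Hd'. rewrite wdist_refl in Hd'. apply Rabs_def2 in Hd'.
    pose proof (wdist_tri nat_weight (pr y) (iota (IZR m + e * sigmoid (ri i))) (iota (IZR m))) as T.
    rewrite (wdist_sym nat_weight (pr y) (iota (IZR m + _))) in T. lra. }
  destruct (Hp y Hfib) as [s [Hs Es]].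
  destruct (CG y eps Heps) as [d [Hd Hd']].
  destruct (Hy d Hd 0%nat) as [i [_ Hi]]. rewrite dist_sym in Hi. specialize (Hd' _ Hi).
  apply (proj2 (Hri i) s Hs). rewrite <- Es, wdist_sym.
  eapply Rle_lt_trans; [apply pr_dist|exact Hd'].
Qed.

Lemma solenoid_dense_neg (x z : nat -> C) (eps : R) :
  solenoid x -> solenoid z -> 0 < eps ->
  exists n, wdist nat_weight (flow x (- INR n)) z < eps.
Proof.
  intros Hx Hz He.
  destruct (solenoid_dense (sconj x) (sconj z) eps 0 (solenoid_conj x Hx) (solenoid_conj z Hz) He)
    as [n [_ Hn]].
  exists n. eapply Rle_lt_trans; [|exact Hn]. right. apply wdist_ext. intros k.
  assert (E : flow x (- INR n) = sconj (flow (sconj x) (INR n)))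
    by (now rewrite sconj_flow, sconj_sconj).
  rewrite E. rewrite <- Cmod_conj. f_equal. unfold sconj at 1. apply C_ext; simpl; ring.
Qed.

(* If the image of the cell lay on another leaf, its end would either have a limit point on that
   leaf or contain a half-leaf, which is dense; both are impossible since the image of the end
   clusters only at the arc [iota [p, p + 1]]. *)
Lemma cell_follows_fibre (G : Y -> Y) m e y : mcont Y Y G -> (e = 1 \/ e = -1) ->
  on_fibre m y -> on_leaf (G y) -> on_leaf (G (cell_path m e 0)).
Proof.
  intros CG He Hy HG. destruct (fibre_to_cell G m y CG Hy HG) as [p Hp].
  apply NNPP. intros Hoff.
  destruct (Y_path (fun r => G (cell_path m e r))) as [th [Ct [T0 Hth]]].
  { exact (mcont_comp R_metric Y Y _ _ (cell_path_cont m e He) CG). }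
  set (x0 := pr (G (cell_path m e 0))) in *.
  assert (Sx0 : solenoid x0) by apply pr_solenoid.
  assert (Hnear : forall eps, 0 < eps -> exists r0, forall r, r <= r0 ->
            exists s, IZR p <= s <= IZR p + 1 /\ wdist nat_weight (flow x0 (th r)) (iota s) < eps).
  { intros eps Heps. destruct (wdist_near_cell_path G m e p eps CG He Hp Heps) as [r0 Hr0].
    exists r0. intros r Hr. rewrite <- Hth. now apply Hr0. }
  destruct (classic (exists B r1, forall r, r <= r1 -> Rabs (th r) <= B)) as [[B [r1 HB]]|Hunb].
  (* Bounded flow times: moving nearby arc points back by [th r] puts [x0] in the closure of a fixed
     compact arc of the leaf. *)
  - apply Hoff. destruct (iota_compact x0 (IZR p - B) (IZR p + 1 + B)) as [s [_ Es]].
    + intros eps Heps. destruct (Hnear eps Heps) as [r0 Hr0].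
      set (r := Rmin r0 r1). destruct (Hr0 r (Rmin_l _ _)) as [s [Hs Hd]].
      pose proof (HB r (Rmin_r _ _)) as Hr. apply Rcomplements.Rabs_le_between in Hr.
      exists (s - th r). split; [lra|].
      rewrite <- (wdist_flow _ _ (th r)), flow_iota.
      now replace (s - th r + th r) with s by ring.
    + now exists s.
  (* Unbounded flow times: [z] is at positive distance from the arc, yet the image comes near it at
     some parameter below [r0]. *)
  - set (z := iota (IZR p + 2)).
    assert (Hz : exists eps, 0 < eps /\ forall s, IZR p <= s <= IZR p + 1 ->
               eps <= wdist nat_weight z (iota s)).
    { apply NNPP. intros H. destruct (iota_compact z (IZR p) (IZR p + 1)) as [s [Hs Es]].
      - intros eps Heps. apply NNPP. intros H'. apply H. exists eps. split; [exact Heps|].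
        intros s Hs. apply Rnot_lt_le. intros Hlt. apply H'. now exists s.
      - apply iota_inj in Es. lra. }
    destruct Hz as [eps [Heps Hz]].
    destruct (Hnear (eps / 2)) as [r0 Hr0]; [lra|].
    (* The forward time [n] and the backward time [- N - n'] both lead near [z]. The value [th r0]
       lies between them, so a long enough excursion of [th] passes through one of the two. *)
    destruct (INR_unbounded (Rabs (th r0))) as [N HN].
    destruct (solenoid_dense x0 z (eps / 2) N Sx0 (solenoid_iota _)) as [n [Hn Hd]]; [lra|].
    destruct (solenoid_dense_neg (flow x0 (- INR N)) z (eps / 2)) as [n' Hd'];
      [apply solenoid_flow, Sx0|apply solenoid_iota|lra|].
    rewrite flow_add in Hd'.
    assert (Hbad : forall r, r <= r0 -> wdist nat_weight (flow x0 (th r)) z < eps / 2 -> False).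
    { intros r Hr Hd2. destruct (Hr0 r Hr) as [s [Hs Hds]]. specialize (Hz s Hs).
      pose proof (wdist_tri nat_weight z (flow x0 (th r)) (iota s)) as T.
      rewrite (wdist_sym nat_weight z (flow x0 (th r))) in T. lra. }
    assert (Hbig : exists r, r <= r0 /\ INR n + INR N + INR n' < Rabs (th r)).
    { apply NNPP. intros H. apply Hunb. exists (INR n + INR N + INR n'), r0. intros r Hr.
      apply Rnot_lt_le. intros Hlt. apply H. now exists r. }
    destruct Hbig as [r [Hr Hbig]].
    pose proof (pos_INR n). pose proof (pos_INR N). pose proof (pos_INR n').
    apply le_INR in Hn. apply Rabs_def2 in HN.
    destruct (Rle_dec 0 (th r)) as [Hpos|Hneg].
    + rewrite Rabs_pos_eq in Hbig by exact Hpos.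
      destruct (IVT_value th r r0 (INR n) Ct Hr) as [u [Hu Eu]]; [right; lra|].
      apply (Hbad u); [lra|]. now rewrite Eu.
    + rewrite Rabs_left in Hbig by lra.
      destruct (IVT_value th r r0 (- INR N + - INR n') Ct Hr) as [u [Hu Eu]]; [left; lra|].
      apply (Hbad u); [lra|]. now rewrite Eu.
Qed.

Lemma cell_path_half m e : cell_path m e 0 = iota_pt (IZR m + e * / 2).
Proof. unfold cell_path, sigmoid. rewrite Ropp_0, exp_0. reflexivity. Qed.

(** Some cell is good because a preimage of [iota_pt 0] lies on the leaf; goodness passes to both
    neighbours through the shared circle, whose image is then on the leaf. *)
Lemma cell_map (G : Y -> Y) : mcont Y Y G -> surjective G ->
  exists m : Z -> Z, forall n y, on_cell n y -> on_cell (m n) (G y).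
Proof.
  intros CG SG.
  set (good := fun n => exists p, forall y, on_cell n y -> on_cell p (G y)).
  assert (Hright : forall n y, on_fibre n y -> on_leaf (G y) -> good n).
  { intros n y Hy HG. apply (cell_of_path G n 0 CG).
    apply (cell_follows_fibre G n 1 y); auto. }
  assert (Hleft : forall n y, on_fibre n y -> on_leaf (G y) -> good (n - 1)%Z).
  { intros n y Hy HG. apply (cell_of_path G (n - 1) 0 CG).
    replace (cell_path (n - 1) 1 0) with (cell_path n (-1) 0).
    - apply (cell_follows_fibre G n (-1) y); auto.
    - rewrite !cell_path_half, minus_IZR. f_equal. field. }
  assert (Hleaf : forall p y, on_cell p y -> on_leaf y) by (intros p y [s [_ E]]; now exists s).
  assert (Hstep : forall n, good n <-> good (Z.succ n)).
  { intros n. split; intros [p Hp].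
    - assert (Hy : on_fibre (Z.succ n) (iota_pt (IZR (Z.succ n)))) by reflexivity.
      apply (Hright _ _ Hy). apply (Hleaf p), Hp.
      apply fibre_in_cell_pred in Hy. now replace (Z.succ n - 1)%Z with n in Hy by lia.
    - assert (Hy : on_fibre (Z.succ n) (iota_pt (IZR (Z.succ n)))) by reflexivity.
      replace n with (Z.succ n - 1)%Z by lia.
      apply (Hleft _ _ Hy). apply (Hleaf p), Hp. now apply fibre_in_cell. }
  assert (Hinit : exists n, good n).
  { destruct (SG (iota_pt 0)) as [y Ey].
    assert (HG : on_leaf (G y)) by (rewrite Ey; now exists 0).
    destruct (off_leaf_map G y CG SG HG) as [s Es].
    destruct (base_Int_part s) as [B1 B2]. set (n := Int_part s) in *. exists n.
    destruct (Req_dec s (IZR n)) as [E|E].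
    - apply (Hright n y); [|exact HG]. unfold on_fibre. now rewrite Es, E.
    - destruct (sigmoid_surj (s - IZR n)) as [r Hr]; [lra|].
      apply (cell_of_path G n r CG).
      replace (cell_path n 1 r) with y; [exact HG|].
      apply pt_eq.
      + apply not_int_iota; [now left|apply sigmoid_range].
      + rewrite Es, Hr. f_equal. ring. }
  destruct Hinit as [n0 Hn0].
  assert (Hall : forall n, good n).
  { assert (H : forall k, good (n0 + k)%Z).
    { apply Z.bi_induction.
      - now intros a b ->.
      - now rewrite Z.add_0_r.
      - intros k. rewrite Z.add_succ_r. apply Hstep. }
    intros n. replace n with (n0 + (n - n0))%Z by lia. apply H. }
  exists (fun n => proj1_sig (constructive_indefinite_description _ (Hall n))).
  intros n. now destruct (constructive_indefinite_description _ (Hall n)).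
Qed.

(** Consecutive cells share a circle, so their images share a point. *)
Lemma cell_map_step (G : Y -> Y) m : (forall n y, on_cell n y -> on_cell (m n) (G y)) ->
  forall n, (Z.abs (m (n + 1) - m n) <= 1)%Z.
Proof.
  intros Hm n. set (y := iota_pt (IZR (n + 1))).
  assert (Hy : on_fibre (n + 1) y) by reflexivity.
  apply (cell_meet _ _ (G y)); apply Hm; [now apply fibre_in_cell|].
  replace n with (n + 1 - 1)%Z by lia. now apply fibre_in_cell_pred.
Qed.

(** * Rigidity: maps determined by far cells *)

Lemma shift_dense y0 y eps N : 0 < eps ->
  exists n, (N <= n)%nat /\ dist y (shift (Z.of_nat n) y0) < eps.
Proof.
  intros He. destruct (Y_fibre_dense (pr y0) y eps N (pr_solenoid y0) He) as [n [Hn H]].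
  exists n. split; [exact Hn|]. apply H. rewrite pr_shift, <- INR_IZR_INZ. reflexivity.
Qed.

Lemma on_fibre_shift k n y : on_fibre n y -> on_fibre (n + k) (shift k y).
Proof. unfold on_fibre. intros H. now rewrite pr_shift, H, flow_iota, plus_IZR. Qed.

(* The fibres over [iota n] with [n] large are dense and their diameters tend to [0]. *)
Lemma rigidity (G : Y -> Y) (k : Z) (N : nat) : mcont Y Y G ->
  (forall n, (Z.of_nat N <= n)%Z -> forall y, on_cell n y -> on_cell (n + k) (G y)) ->
  forall y, G y = shift k y.
Proof.
  intros CG H y. apply dist_eq0. apply Rle_antisym; [|apply dist_nonneg].
  apply le_epsilon. intros eps He. rewrite Rplus_0_l. left.
  destruct (CG y (eps / 3)) as [d1 [Hd1 H1]]; [lra|].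
  destruct (shift_cont k y (eps / 3)) as [d2 [Hd2 H2]]; [lra|].
  destruct (Pow_x_infinity 2) with (b := 3 / eps + 1) as [M HM]; [rewrite Rabs_pos_eq; lra|].
  set (y0 := iota_pt 0).
  (* [N + 1] puts both cells adjacent to the circle over [iota n] within the range of [H]; adding
     [M] and the size of [k] gives [|n + k|] at least [M], so the image circle is small. *)
  destruct (shift_dense y0 y (Rmin d1 d2) (N + 1 + M + Z.abs_nat k)) as [n [Hn Hd]];
    [now apply Rmin_pos|].
  set (z := shift (Z.of_nat n) y0) in *.
  assert (Hz : on_fibre (Z.of_nat n) z).
  { assert (H0 : on_fibre 0 y0) by reflexivity.
    exact (on_fibre_shift (Z.of_nat n) 0 y0 H0). }
  specialize (H1 z). specialize (H2 z).
  pose proof (Rmin_l d1 d2). pose proof (Rmin_r d1 d2).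
  specialize (H1 ltac:(lra)). specialize (H2 ltac:(lra)).
  (* A circle is the intersection of the two adjacent cells, so it follows them. *)
  assert (HG : on_fibre (Z.of_nat n + k) (G z)).
  { apply fibre_of_cells.
    - replace (Z.of_nat n + k - 1)%Z with (Z.of_nat n - 1 + k)%Z by lia.
      apply H; [lia|]. now apply fibre_in_cell_pred.
    - apply H; [lia|]. now apply fibre_in_cell. }
  pose proof (fibre_dist _ _ _ HG (on_fibre_shift k _ _ Hz)) as Hfib.
  specialize (HM (Z.abs_nat (Z.of_nat n + k)) ltac:(lia)).
  rewrite Rabs_pos_eq in HM by (left; apply pow2_pos).
  assert (Hsm : / 2 ^ Z.abs_nat (Z.of_nat n + k) < eps / 3).
  { rewrite <- (Rinv_inv (eps / 3)).
    assert (Hp : 0 < 3 / eps) by (apply Rdiv_lt_0_compat; lra).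
    replace (/ (eps / 3)) with (3 / eps) by (field; lra).
    apply Rinv_lt_contravar; [|lra]. pose proof (pow2_pos (Z.abs_nat (Z.of_nat n + k))). nra. }
  pose proof (dist_tri Y (G y) (G z) (shift k y)) as T1.
  pose proof (dist_tri Y (G z) (shift k z) (shift k y)) as T2.
  rewrite (dist_sym Y (shift k z) (shift k y)) in T2. lra.
Qed.

Lemma eventually_const (f : nat -> Z) :
  (forall i, (f (S i) <= f i)%Z) -> (forall i, (0 <= f i)%Z) ->
  exists N, forall i, (N <= i)%nat -> f i = f N.
Proof.
  intros Hdec Hpos.
  assert (D : forall b, (0 <= b)%Z -> forall i0, (f i0 <= b)%Z ->
            exists N, forall i, (N <= i)%nat -> f i = f N).
  { intros b Hb. pattern b. apply Zlt_0_ind; [|exact Hb].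
    clear b Hb. intros b IH Hb i0 Hi0.
    assert (Hmon : forall i j, (i <= j)%nat -> (f j <= f i)%Z).
    { intros i j Hij. induction Hij as [|j Hij IHj]; [lia|]. specialize (Hdec j). lia. }
    destruct (classic (exists j, (i0 <= j)%nat /\ (f j < f i0)%Z)) as [[j [Hj Hlt]]|Hno].
    - pose proof (Hpos j). apply (IH (b - 1)%Z) with (i0 := j); lia.
    - exists i0. intros i Hi. specialize (Hmon i0 i Hi).
      destruct (Z.eq_dec (f i) (f i0)) as [E|E]; [exact E|]. exfalso. apply Hno.
      exists i. split; [exact Hi|lia]. }
  exact (D (f 0%nat) (Hpos 0%nat) 0%nat (Z.le_refl _)).
Qed.

(** [m] grows by at most [1] per step, so [m n - n] does not increase; being positive, it is
    constant for large [n], which is all that [rigidity] asks. *)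
Lemma forward_is_shift (G : Y -> Y) m : mcont Y Y G ->
  (forall n y, on_cell n y -> on_cell (m n) (G y)) -> (forall n, (n < m n)%Z) ->
  exists k, forall y, G y = shift k y.
Proof.
  intros CG Hm Hpos. pose proof (cell_map_step G m Hm) as Hs.
  destruct (eventually_const (fun i => (m (Z.of_nat i) - Z.of_nat i)%Z)) as [N HN].
  - intros i. specialize (Hs (Z.of_nat i)). rewrite Nat2Z.inj_succ. unfold Z.succ. lia.
  - intros i. specialize (Hpos (Z.of_nat i)). lia.
  - exists (m (Z.of_nat N) - Z.of_nat N)%Z. apply (rigidity G _ N CG).
    intros n Hn y Hy. specialize (HN (Z.to_nat n) ltac:(lia)).
    cbv beta in HN. rewrite Z2Nat.id in HN by lia.
    replace (n + (m (Z.of_nat N) - Z.of_nat N))%Z with (m n) by lia. now apply Hm.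
Qed.

(** * Minimal maps and homeomorphisms *)

(** The arc [[n, n + 1]] is reversed to [[- n - 1, - n]], and cells are indexed by the left end. *)
Lemma reflect_cell n y : on_cell n y -> on_cell (- n - 1) (reflect y).
Proof.
  intros [s [Hs E]]. exists (- s). rewrite pr_reflect, E, sconj_iota, minus_IZR, opp_IZR.
  split; [lra|reflexivity].
Qed.

Lemma iter_succ_inner (f : Y -> Y) n y : iter Y (S n) f y = iter Y n f (f y).
Proof. induction n as [|n IH]; [reflexivity|]. simpl in *. now rewrite IH. Qed.

(** The image of [G] is closed by compactness and contains the orbit of [G y0], which is dense. *)
Lemma minimal_surjective (G : Y -> Y) : minimal Y G -> surjective G.
Proof.
  intros [CG HG] y. set (y0 := iota_pt 0).
  assert (H : forall i : nat, exists n, dist (iter Y n G (G y0)) y < / INR (S i)).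
  { intros i. destruct (HG (G y0) y _ (inv_INR_pos i)) as [a [[n ->] Hn]]. now exists n. }
  set (n := fun i => proj1_sig (constructive_indefinite_description _ (H i))).
  assert (Hn : forall i, dist (iter Y (n i) G (G y0)) y < / INR (S i)).
  { intros i. unfold n. now destruct (constructive_indefinite_description _ (H i)). }
  destruct (compact_cluster Y Y_compact (fun i => iter Y (n i) G y0)) as [z Hz].
  exists z. apply dist_eq0. apply Rle_antisym; [|apply dist_nonneg].
  apply le_epsilon. intros eps He. rewrite Rplus_0_l. left.
  destruct (CG z (eps / 2)) as [d [Hd Hd']]; [lra|].
  destruct (archi_small (eps / 2)) as [N HN]; [lra|].
  destruct (Hz d Hd N) as [i [Hi Hzi]]. rewrite dist_sym in Hzi. specialize (Hd' _ Hzi).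
  specialize (Hn i). rewrite <- iter_succ_inner in Hn.
  change (iter Y (S (n i)) G y0) with (G (iter Y (n i) G y0)) in Hn. specialize (HN i Hi).
  pose proof (dist_tri Y (G z) (G (iter Y (n i) G y0)) y). lra.
Qed.

(** An orbit started in one of the cells would never leave their union, which is closed and misses a
    point further along the leaf. The case [n = n'] handles a single invariant cell. *)
Lemma minimal_no_invariant_cells (G : Y -> Y) n n' : minimal Y G ->
  (forall y, on_cell n y \/ on_cell n' y -> on_cell n (G y) \/ on_cell n' (G y)) -> False.
Proof.
  intros [CG HG] Hinv. set (y0 := iota_pt (IZR n)).
  assert (H0 : on_cell n y0) by (apply fibre_in_cell; reflexivity).
  assert (Hit : forall i, on_cell n (iter Y i G y0) \/ on_cell n' (iter Y i G y0)).
  { induction i as [|i IH]; [now left|]. now apply Hinv. }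
  set (M := Z.max n n'). set (z := iota_pt (IZR M + 2)).
  assert (Hz : forall j, (j <= M)%Z -> exists eps, 0 < eps /\ forall y, dist z y < eps -> ~ on_cell j y).
  { intros j Hj. apply NNPP. intros H.
    assert (Hc : on_cell j z).
    { apply cell_closed. intros eps He. apply NNPP. intros H'. apply H. exists eps.
      split; [exact He|]. intros y Hy Hjy. apply H'. now exists y. }
    destruct Hc as [s [Hs E]]. unfold z, iota_pt in E. rewrite pr_pt in E. apply iota_inj in E.
    apply IZR_le in Hj. lra. }
  destruct (Hz n) as [e1 [He1 H1]]; [unfold M; lia|].
  destruct (Hz n') as [e2 [He2 H2]]; [unfold M; lia|].
  destruct (HG y0 z (Rmin e1 e2)) as [a [[i ->] Ha]]; [now apply Rmin_pos|].
  rewrite dist_sym in Ha. pose proof (Rmin_l e1 e2). pose proof (Rmin_r e1 e2).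
  destruct (Hit i) as [Hi|Hi]; [apply (H1 (iter Y i G y0))|apply (H2 (iter Y i G y0))]; auto; lra.
Qed.

Lemma minimal_is_shift (G : Y -> Y) : minimal Y G -> exists k, forall y, G y = shift k y.
Proof.
  intros HG. assert (CG : mcont Y Y G) by apply HG.
  destruct (cell_map G CG (minimal_surjective G HG)) as [m Hm].
  pose proof (cell_map_step G m Hm) as Hs.
  assert (Hfix : forall n, m n <> n).
  { intros n E. apply (minimal_no_invariant_cells G n n HG).
    intros y Hy. left. rewrite <- E. apply Hm. tauto. }
  assert (Hswap : forall n, ~ (m n = n + 1 /\ m (n + 1) = n)%Z).
  { intros n [E1 E2]. apply (minimal_no_invariant_cells G n (n + 1) HG).
    intros y [Hy|Hy]; apply Hm in Hy; rewrite ?E1, ?E2 in Hy; tauto. }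
  (* [m n - n] drops by [0], [1] or [2] per step and never vanishes, so it can change sign only from
     [1] to [-1], the exchange excluded by [Hswap]. *)
  assert (Hsign : forall n, (n < m n)%Z <-> (Z.succ n < m (Z.succ n))%Z).
  { intros n. specialize (Hs n). pose proof (Hfix n). pose proof (Hfix (n + 1)%Z).
    specialize (Hswap n). unfold Z.succ. lia. }
  assert (Hall : forall n, (n < m n)%Z <-> (0 < m 0)%Z).
  { intros n. pattern n. apply Z.bi_induction; clear n.
    - now intros a b ->.
    - tauto.
    - intros n. rewrite (Hsign n). tauto. }
  destruct (Z_lt_dec 0 (m 0%Z)) as [Hpos|Hneg].
  - apply (forward_is_shift G m CG Hm). intros n. now apply Hall.
  (* The negative case is conjugated by [reflect]: the displacement of the new cell map at [n] is
     opposite to that of [m] at [- n - 1]. *)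
  - destruct (forward_is_shift (fun y => reflect (G (reflect y))) (fun n => - m (- n - 1) - 1)%Z)
      as [k Hk].
    + apply (mcont_comp Y Y Y (fun y => G (reflect y)) reflect).
      * exact (mcont_comp Y Y Y _ _ reflect_cont CG).
      * apply reflect_cont.
    + intros n y Hy. apply reflect_cell, Hm, reflect_cell, Hy.
    + intros n. pose proof (proj1 (Hall (- n - 1)%Z)). pose proof (Hfix (- n - 1)%Z). lia.
    + exists (- k)%Z. intros y.
      rewrite <- (reflect_reflect (G y)), <- (reflect_reflect y) at 1.
      rewrite Hk, reflect_shift, reflect_reflect. reflexivity.
Qed.

(** The inverse also acts on cells, so [m] is injective; with steps of size at most [1] it never
    turns back and is affine of slope [e]. Slope [-1] becomes [1] after composing with [reflect],
    and [rigidity] applies. *)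
Lemma homeo_is_shift_or_reflection (h : Y -> Y) : homeo Y h ->
  (exists k, h = shift k) \/ (exists k, h = fun y => shift k (reflect y)).
Proof.
  intros [Ch [g [Cg [Hgh Hhg]]]].
  destruct (cell_map h Ch) as [m Hm]; [intros y; now exists (g y)|].
  destruct (cell_map g Cg) as [m' Hm']; [intros y; now exists (h y)|].
  assert (Hinv : forall n, m' (m n) = n).
  (* The midpoint of a cell lies in no other cell, so it identifies the index. *)
  { intros n. set (y := iota_pt (IZR n + / 2)).
    assert (Hy : on_cell n y) by (exists (IZR n + / 2); split; [lra|reflexivity]).
    apply Hm in Hy. apply Hm' in Hy. rewrite Hgh in Hy. destruct Hy as [s [Hs E]].
    unfold y, iota_pt in E. rewrite pr_pt in E. apply iota_inj in E. subst s.
    assert ((m' (m n) < n + 1)%Z) by (apply lt_IZR; rewrite plus_IZR; lra).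
    assert ((n < m' (m n) + 1)%Z) by (apply lt_IZR; rewrite plus_IZR; lra). lia. }
  assert (Hinj : forall a b, m a = m b -> a = b).
  { intros a b E. rewrite <- (Hinv a), E. apply Hinv. }
  pose proof (cell_map_step h m Hm) as Hs.
  set (e := (m (0 + 1) - m 0)%Z).
  assert (He : (e = 1 \/ e = -1)%Z).
  { pose proof (Hs 0%Z). assert (m (0 + 1)%Z <> m 0%Z) by (intros E; apply Hinj in E; lia).
    unfold e. lia. }
  assert (Hd : forall n, (m (n + 1) - m n = e)%Z).
  { intros n. pattern n. apply Z.bi_induction; clear n.
    - now intros a b ->.
    - reflexivity.
    - intros n. unfold Z.succ. pose proof (Hs n). pose proof (Hs (n + 1)%Z).
      assert (m (n + 1)%Z <> m n) by (intros E; apply Hinj in E; lia).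
      assert (m (n + 1 + 1)%Z <> m (n + 1)%Z) by (intros E; apply Hinj in E; lia).
      assert (m (n + 1 + 1)%Z <> m n) by (intros E; apply Hinj in E; lia). lia. }
  assert (Hlin : forall n, m n = (m 0 + e * n)%Z).
  { intros n. pattern n. apply Z.bi_induction; clear n.
    - now intros a b ->.
    - lia.
    - intros n. unfold Z.succ. specialize (Hd n). lia. }
  destruct He as [E|E].
  - left. exists (m 0%Z). apply functional_extensionality.
    apply (rigidity h _ 0 Ch). intros n _ y Hy. apply Hm in Hy. rewrite Hlin, E in Hy.
    now replace (n + m 0)%Z with (m 0 + 1 * n)%Z by lia.
  - right. exists (m 0 + 1)%Z. apply functional_extensionality. intros y.
    assert (H : reflect (h y) = shift (- m 0 - 1)%Z y).
    { revert y. apply (rigidity (fun y => reflect (h y)) _ 0).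
      - exact (mcont_comp Y Y Y _ _ Ch reflect_cont).
      - intros n _ y Hy. apply Hm, reflect_cell in Hy. rewrite Hlin, E in Hy.
        now replace (n + (- m 0 - 1))%Z with (- (m 0 + -1 * n) - 1)%Z by lia. }
    rewrite <- (reflect_reflect (h y)), H, reflect_shift. f_equal. lia.
Qed.

(** * The group of homeomorphisms of [Y] *)

Lemma shift_cancel a b y : (a + b = 0)%Z -> shift a (shift b y) = y.
Proof. intros H. rewrite shift_add, H. apply shift_0. Qed.

Lemma shift_homeo k : homeo Y (shift k).
Proof.
  split; [apply shift_cont|]. exists (shift (- k)). split; [apply shift_cont|].
  split; intros y; apply shift_cancel; lia.
Qed.

Lemma shift_reflect_involutive k y : shift k (reflect (shift k (reflect y))) = y.
Proof.
  rewrite reflect_shift, reflect_reflect. apply shift_cancel. lia.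
Qed.

Lemma shift_reflect_homeo k : homeo Y (fun y => shift k (reflect y)).
Proof.
  assert (Cf : mcont Y Y (fun y => shift k (reflect y)))
    by exact (mcont_comp Y Y Y _ _ reflect_cont (shift_cont k)).
  split; [exact Cf|]. exists (fun y => shift k (reflect y)).
  split; [exact Cf|]. split; apply shift_reflect_involutive.
Qed.

(** The two maps send [iota n] to [iota (- n)] and to [iota (n + k)]; [n = 0] and [n = 1] disagree
    on [k]. *)
Lemma reflect_not_shift k : reflect <> shift k.
Proof.
  intros H.
  assert (E : forall n, iota (- IZR n) = iota (IZR n + IZR k)).
  { intros n. rewrite <- sconj_iota, <- flow_iota.
    change (pr (reflect (iota_pt (IZR n))) = pr (shift k (iota_pt (IZR n)))). now rewrite H. }
  pose proof (iota_inj _ _ (E 0%Z)). pose proof (iota_inj _ _ (E 1%Z)). lra.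
Qed.

Lemma iter_shift n k y : iter Y n (shift k) y = shift (k * Z.of_nat n) y.
Proof.
  induction n as [|n IH].
  - simpl. rewrite Z.mul_0_r. symmetry. apply shift_0.
  - simpl iter. rewrite IH, shift_add. f_equal. lia.
Qed.

Lemma zpow_shift k n : zpow Y (shift k) (shift (- k)) n = shift (k * n).
Proof.
  apply functional_extensionality. intros y. destruct n as [|p|p].
  - simpl. rewrite Z.mul_0_r. symmetry. apply shift_0.
  - simpl zpow. rewrite iter_shift. f_equal. lia.
  - simpl zpow. rewrite iter_shift. f_equal. lia.
Qed.

Lemma zpow_shift_1 n : zpow Y (shift 1) (shift (-1)) n = shift n.
Proof. change (-1)%Z with (- (1))%Z. rewrite zpow_shift. f_equal. lia. Qed.

Lemma shift_1_minimal : minimal Y (shift 1).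
Proof.
  split; [apply shift_cont|]. intros x y eps He.
  destruct (shift_dense x y eps 0 He) as [n [_ Hn]]. exists (shift (Z.of_nat n) x). split.
  - exists n. rewrite iter_shift. f_equal. lia.
  - now rewrite dist_sym.
Qed.

Lemma shift_inverse k : is_inverse Y (shift k) (shift (- k)).
Proof. split; intros y; apply shift_cancel; lia. Qed.

Lemma Y_almost_slovak : almost_slovak Y.
Proof.
  exists (shift 1), (shift (-1)),
    (* The identity is put into [Hm] because its intersection with the powers of [T] has to be
       exactly the identity. *)
    (fun h => h = (fun y => y) \/ exists k, h = fun y => shift k (reflect y)).
  split; [apply shift_homeo|]. split; [apply (shift_inverse 1)|]. split; [apply shift_1_minimal|].
  assert (Hid : (fun y : Y => y) = shift 0).
  { apply functional_extensionality. intros y. symmetry. apply shift_0. }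
  cbv zeta. split; [|split].
  - intros h. split.
    + intros Hh. destruct (homeo_is_shift_or_reflection h Hh) as [[k ->]|[k ->]].
      * left. exists k. symmetry. apply zpow_shift_1.
      * right. right. now exists k.
    + intros [[k ->]|[->|[k ->]]].
      * rewrite zpow_shift_1. apply shift_homeo.
      * rewrite Hid. apply shift_homeo.
      * apply shift_reflect_homeo.
  - intros h. split.
    + intros [[n En] [->|[k Ek]]]; [reflexivity|]. exfalso.
      (* A map equal both to [shift n] and to [shift k] after [reflect] would make [reflect] the
         shift by [n - k]. *)
      apply (reflect_not_shift (n - k)). apply functional_extensionality. intros y.
      rewrite zpow_shift_1 in En. rewrite En in Ek.
      rewrite <- (shift_0 (reflect y)). replace 0%Z with (- k + k)%Z by lia.
      rewrite <- shift_add. change (shift k (reflect y)) with ((fun y => shift k (reflect y)) y).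
      rewrite <- Ek, shift_add. f_equal. lia.
    + intros ->. split; [|now left]. exists 0%Z. reflexivity.
  - intros g [->|[k ->]]; exists 0%Z; [reflexivity|].
    apply functional_extensionality. intros y. apply shift_reflect_involutive.
Qed.

(** A minimal generator is some [shift k], so all its powers are shifts, and [reflect] is a
    homeomorphism that is none of them. *)
Lemma Y_not_slovak : ~ slovak Y.
Proof.
  intros [_ [S [Sinv [_ [[HS _] [Smin Hall]]]]]].
  destruct (minimal_is_shift S Smin) as [k Hk].
  assert (ES : S = shift k) by (now apply functional_extensionality). subst S.
  assert (Ei : Sinv = shift (- k)).
  { apply functional_extensionality. intros y.
    rewrite <- (proj2 (shift_inverse k) y) at 1. apply HS. }
  subst Sinv.
  assert (Hr : homeo Y reflect).
  { assert (E : reflect = fun y => shift 0 (reflect y)).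
    { apply functional_extensionality. intros y. now rewrite shift_0. }
    rewrite E. apply shift_reflect_homeo. }
  apply Hall in Hr. destruct Hr as [n Hn]. rewrite zpow_shift in Hn.
  exact (reflect_not_shift _ Hn).
Qed.

Lemma Y_continuum : continuum Y.
Proof.
  split; [apply Y_compact|]. split; [apply Y_connected|].
  exists (iota_pt 0), (iota_pt 1). intros E. apply (f_equal pr) in E.
  unfold iota_pt in E. rewrite !pr_pt in E. apply iota_inj in E. lra.
Qed.

Theorem theorem3p2 :
  exists Y : MetricSpace,
    continuum Y /\ almost_slovak Y /\ ~ slovak Y /\
    (forall G : Y -> Y, minimal Y G -> homeo Y G).
Proof.
  exists Y. split; [apply Y_continuum|]. split; [apply Y_almost_slovak|].
  split; [apply Y_not_slovak|]. intros G HG.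
  destruct (minimal_is_shift G HG) as [k Hk].
  assert (E : G = shift k) by (now apply functional_extensionality).
  rewrite E. apply shift_homeo.
Qed.
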